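(* Let $(X,d)$ be a doubling metric space and let $\mu$ be a nonzero locally finite Borel measure on $X$. Then the conformal dimension of $\mu$ is $\dim_{\mathrm C}\mu=0$.
   Context: A metric space is doubling if there is a uniform $N$ such that every ball can be covered by at most $N$ balls of half the radius. A Borel measure $\mu$ on $X$ is locally finite if every point of $X$ has an open neighborhood of finite $\mu$-measure. The support $\operatorname{spt}\mu$ is the set of points every open neighborhood of which has positive $\mu$-measure. $\dim_{\mathrm H}$ denotes Hausdorff dimension of sets. The Hausdorff dimension of a Borel measure $\nu$ on a metric space $Y$ is $$\dim_{\mathrm H}\nu=\inf\{\dim_{\mathrm H}E: E\subset Y\text{ Borel},\ \nu(Y\setminus E)=0\}.$$ A homeomorphism $f:(X_1,d_1)\to(X_2,d_2)$ between metric spaces is quasisymmetric if there is a homeomorphism $\eta:[0,\infty)\to[0,\infty)$ with $$\frac{d_2(f(x),f(a))}{d_2(f(x),f(b))}\le\eta\!\left(\frac{d_1(x,a)}{d_1(x,b)}\right)$$ for all distinct $x,a,b\in X_1$. With $S=\operatorname{spt}\mu$ and, for a Borel map $f:S\to Y$, $f_\#\mu(A)=\mu(f^{-1}(A))$, the conformal dimension of $\mu$ is $$\dim_{\mathrm C}\mu=\inf_f\dim_{\mathrm H}(f_\#\mu),$$ where $f$ ranges over all quasisymmetric homeomorphisms from $(S,d)$ onto metric spaces. (Since a doubling space is separable, $\mu(X\setminus S)=0$ automatically.) *)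

(* Defs.v *)
From HB Require Import structures.
From mathcomp Require Import all_boot all_order all_algebra.
From mathcomp Require Import all_classical all_reals all_analysis.

Set Implicit Arguments.
Unset Strict Implicit.
Unset Printing Implicit Defensive.

Import Order.TTheory GRing.Theory Num.Theory.
Import numFieldNormedType.Exports.

Local Open Scope classical_set_scope.
Local Open Scope ring_scope.

(* Measurable types are pointed in the library, so a metric space that carries
   a measure has to be inhabited.  A space with a nonzero measure always is. *)
#[short(type="pmetricType")]
HB.structure Definition PointedMetric (R : numDomainType) :=
  {T of Pointed T & Metric R T}.

Definition borel {T : topologicalType} : set (set T) := <<s @open T >>.

Notation borel_measure X R :=
  ({measure set (g_sigma_algebraType (@open X)) -> \bar R}).

Section metric.
Context {R : realType}.

Definition doubling (X : metricType R) :=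
  exists N : nat, forall (x : X) (r : R), 0 < r ->
    exists2 c : seq X, (size c <= N)%N &
      ball x r `<=` \bigcup_(y in [set` c]) ball y (r / 2).

Local Open Scope ereal_scope.

(* 0 is inserted so that the diameter of the empty set is 0, not -oo. *)
Definition diameter (X : metricType R) (U : set X) : \bar R :=
  ereal_sup (0 |` [set (mdist x y)%:E | x in U & y in U]).

(* diam(U)^s, with 0^0 = 1 for nonempty U and value 0 on the empty set, so that
   padding a finite cover with empty sets never costs anything. *)
Definition hausdorff_gauge (X : metricType R) (s : R) (U : set X) : \bar R :=
  if U == set0 then 0 else diameter U `^ s.

Definition hausdorff_content (X : metricType R) (s delta : R) (E : set X) :
    \bar R :=
  ereal_inf [set \sum_(0 <= i <oo) hausdorff_gauge s (U i) |
    U in [set U : nat -> set X | E `<=` \bigcup_i U i /\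
                                 forall i, diameter (U i) <= delta%:E]].

Definition hausdorff_measure (X : metricType R) (s : R) (E : set X) : \bar R :=
  ereal_sup [set hausdorff_content s delta E |
    delta in [set delta : R | (0 < delta)%R]].

Definition hausdorff_dim (X : metricType R) (E : set X) : \bar R :=
  ereal_inf [set s%:E |
    s in [set s : R | (0 <= s)%R /\ hausdorff_measure s E = 0]].

Definition measure_hausdorff_dim (Y : metricType R) (nu : set Y -> \bar R) :
    \bar R :=
  ereal_inf [set hausdorff_dim E | E in [set E | borel E /\ nu (~` E) = 0]].

End metric.

(* f need only be meaningful on A: it restricts to a homeomorphism of the
   subspace A onto the subspace B. *)
Definition homeomorphism_on (T U : topologicalType) (A : set T) (B : set U)
    (f : T -> U) :=
  [/\ set_bij A B f,
      {within A, continuous f} &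
      exists2 g : U -> T, {in A, cancel f g} & {within B, continuous g}].

(* f restricts to a quasisymmetric homeomorphism of (S, d) onto the whole of
   Y; the values of f outside S play no role. *)
Definition quasisymmetric_on (R : realType) (X Y : metricType R) (S : set X)
    (f : X -> Y) :=
  homeomorphism_on S [set: Y] f /\
  exists2 eta : R -> R, @homeomorphism_on R R `[0, +oo[ `[0, +oo[ eta &
    forall x a b, S x -> S a -> S b -> x <> a -> x <> b -> a <> b ->
      mdist (f x) (f a) / mdist (f x) (f b) <= eta (mdist x a / mdist x b).

Section borel_measures.
Context {R : realType} {X : pmetricType R}.
Local Open Scope ereal_scope.

Definition locally_finite (mu : borel_measure X R) :=
  forall x : X, exists2 U : set X, open_nbhs x U & mu U < +oo.

Definition spt (mu : borel_measure X R) : set X :=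
  [set x | forall U : set X, open_nbhs x U -> 0 < mu U].

(* f_# mu for f defined on S = spt mu: the preimage of A under f|S. *)
Definition spt_pushforward (mu : borel_measure X R) (Y : metricType R)
    (f : X -> Y) : set Y -> \bar R :=
  fun A => mu (spt mu `&` f @^-1` A).

Definition conformal_dim (mu : borel_measure X R) : \bar R :=
  ereal_inf [set t | exists (Y : metricType R) (f : X -> Y),
    quasisymmetric_on (spt mu) f /\
    t = measure_hausdorff_dim (spt_pushforward mu f)].

End borel_measures.

(* Main.v *)
(* For every q, the measure is carried by a set E of Hausdorff dimension at most
   1/q for a suitable quasisymmetric change of metric.  Put r_n = 4^(-l n).  At
   each scale r_n let chi_n be 1 near the spheres of a fixed radius t about the
   points of an r_n/16-net, and 1/8 elsewhere.  There are K disjoint choices of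
   t, and doubling bounds by K/8 the number of those that are bad at a given
   point.  So, given V_n = chi_0 ... chi_(n-1), some choice of t gives
   int V_(n+1) <= 1/4 int V_n, for a finite measure with the null sets of mu.
   Hence, for almost every x, V_n(x) < 2^-n for infinitely many n.  Let W_n =
   2^(-l n) V_n^B, and let rho(x, y) be the infimum of the cost of the chains
   from x to y, where a step from a to b with d(a, b) <= r_n costs
   W_n(a) + W_n(b).  A chain that leaves the ball of radius r_n about x has to
   cross a spherical shell where chi_n = 1, so it costs at least W_n(x) / 2.
   Therefore rho is comparable to W_n(x) at distance about r_n from x, which
   makes the identity quasisymmetric; and if B is large then the set of the x
   with V_n(x) < 2^-n is covered cheaply by balls of radius r_n / 2. *)

Require Import Defs.
From HB Require Import structures.
From mathcomp Require Import all_boot all_order all_algebra.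
From mathcomp Require Import ring lra zify.
From mathcomp Require Import all_classical all_reals all_analysis.
From mathcomp Require Import measurable_realfun.

Set Implicit Arguments.
Unset Strict Implicit.
Unset Printing Implicit Defensive.

Import Order.TTheory GRing.Theory Num.Theory.
Import numFieldNormedType.Exports.

Local Open Scope classical_set_scope.
Local Open Scope ring_scope.

(** * The chain metric of a family of weights *)

Section chain_metric.
Context {R : realType} {X : metricType R}.
Variables (r : int -> R) (W : int -> X -> R).

(** Each step records the level at which it is paid; every level whose radius is at least the length
    of the step is allowed. *)
Fixpoint chain (x : X) (c : seq (int * X)) : bool :=
  if c is (n, y) :: c' then (mdist x y <= r n) && chain y c' else true.

Fixpoint chain_cost (x : X) (c : seq (int * X)) : R :=
  if c is (n, y) :: c' then W n x + W n y + chain_cost y c' else 0.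

Definition chain_end (x : X) (c : seq (int * X)) : X := last x (unzip2 c).

Definition chain_dist (x y : X) : R :=
  inf [set chain_cost x c | c in [set c | chain x c /\ chain_end x c = y]].

Lemma chain_end_cat x c1 c2 :
  chain_end x (c1 ++ c2) = chain_end (chain_end x c1) c2.
Proof. by rewrite /chain_end /unzip2 map_cat last_cat. Qed.

Lemma chain_cat x c1 c2 :
  chain x (c1 ++ c2) = chain x c1 && chain (chain_end x c1) c2.
Proof.
by elim: c1 x => [//|[n y] c1 IH] x /=; rewrite IH andbA.
Qed.

Lemma chain_cost_cat x c1 c2 :
  chain_cost x (c1 ++ c2) = chain_cost x c1 + chain_cost (chain_end x c1) c2.
Proof.
elim: c1 x => [|[n y] c1 IH] x /=; first by rewrite add0r.
by rewrite IH addrA.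
Qed.

Lemma chain_rev x c : chain x c -> exists c',
  [/\ chain (chain_end x c) c', chain_end (chain_end x c) c' = x
    & chain_cost (chain_end x c) c' = chain_cost x c].
Proof.
elim: c x => [|[n y] c IH] x /=; first by exists [::].
case/andP=> xy /IH [c' [c'1 c'2 c'3]].
exists (c' ++ [:: (n, x)]).
have -> : chain_end x ((n, y) :: c) = chain_end y c by [].
rewrite chain_cat chain_end_cat chain_cost_cat c'1 c'2 c'3 /=; split => //.
  by rewrite metric_sym xy.
by rewrite addr0 addrC (addrC (W n y)).
Qed.

Lemma chain_first_exit (P : pred X) x c : P x -> ~~ P (chain_end x c) ->
  exists c1 n y c2,
    [/\ c = c1 ++ (n, y) :: c2, P (chain_end x c1) & ~~ P y].
Proof.
elim: c x => [|[n y] c IH] x /= Px; first by rewrite /chain_end /= Px.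
have [Py|Py] := boolP (P y) => nP.
  have [c1 [m [w [c2 [-> Pc1 Pw]]]]] := IH y Py nP.
  by exists ((n, y) :: c1), m, w, c2.
by exists [::], n, y, c.
Qed.

Hypothesis W_gt0 : forall n x, 0 < W n x.

Lemma chain_cost_ge0 x c : 0 <= chain_cost x c.
Proof.
by elim: c x => //= -[n y] c IH x; rewrite !addr_ge0// ltW.
Qed.

Hypothesis r_noninc : forall n m : int, n <= m -> r m <= r n.
Hypothesis W_noninc : forall (n m : int) x, n <= m -> W m x <= W n x.
Hypothesis W_near : forall n x y, mdist x y <= r n -> W n x <= 2 * W n y.

Variables (lam : R) (J : nat).
Hypothesis r_gt0 : forall n, 0 < r n.
Hypothesis lam_gt0 : 0 < lam.
Hypothesis J_lam : 2 <= J%:R * lam.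
(** The inner ball contains [x], and [2 * t + s <= r n] keeps the outer sphere within [r n] of [x].
    The thickness [s] has room for [J] pieces of width [2 * r (n + 1)] and for one more. *)
Hypothesis shell : forall (n : int) x, exists z t s,
  [/\ mdist z x <= t, 2 * t + s <= r n, J.+1%:R * (2 * r (n + 1)) <= s &
      forall w, t <= mdist z w <= t + s -> lam * W n w <= W (n + 1) w].

(* To leave the ball of radius r n, a chain of small steps has to cross a shell
   on which W (n + 1) is as large as lam * W n.  It crosses it in at least J
   pieces, each of which is bounded below at level n + 1. *)
Lemma chain_cost_lower x c n : chain x c ->
  r n < mdist x (chain_end x c) -> W n x / 2 <= chain_cost x c.
Proof.
(* Strong induction on the length, for all starting points and levels: pieces of the chain are
   treated at level [n + 1]. *)
have [k] := ubnP (size c).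
elim: k c x n => // k IH c x n ck xc far.
have [z [t [s [zx ts Js flat]]]] := shell n x.
set e := r (n + 1) in Js.
have e0 : 0 < e by exact: r_gt0.
have s0 : 0 < s by rewrite (lt_le_trans _ Js)// !mulr_gt0// ltr0n.
have inball u : mdist z u <= t + s -> W n x <= 2 * W n u.
  move=> zu; apply: W_near; apply: le_trans ts.
  have := metric_triangle x z u; rewrite (metric_sym x z); lra.
(* A step at level at most [n] that starts within the outer sphere already pays [W n x / 2]. All
   other steps have length at most [e]. *)
have heavy u m w c1 c2 y : mdist z (chain_end y c1) <= t + s ->
    c2 = c1 ++ (m, w) :: u -> m <= n -> W n x / 2 <= chain_cost y c2.
  move=> zu -> mn; rewrite chain_cost_cat /=.
  have h1 := inball _ zu; have h2 := W_noninc (chain_end y c1) mn.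
  have h3 := chain_cost_ge0 y c1; have h4 := chain_cost_ge0 w u.
  have h5 := W_gt0 m w; lra.
(* A piece ends at the first point more than [e] farther from [z] than its start. Its last step has
   length at most [e], so it uses up at most [2 * e] of the shell. By induction it costs at least
   [W (n + 1) y / 2], hence at least [lam * W n x / 4]. The right alternative covers a heavy
   step. *)
have pieces j c' y : (size c' <= k)%N -> chain y c' ->
    t <= mdist z y -> mdist z y + j%:R * (2 * e) <= t + s ->
    t + s < mdist z (chain_end y c') ->
    j%:R * (lam * W n x / 4) <= chain_cost y c' \/
    W n x / 2 <= chain_cost y c'.
  elim: j c' y => [|j IHj] c' y c'k yc' ty yj out.
    by left; rewrite mul0r chain_cost_ge0.
  have yj' : mdist z y + 2 * e + j%:R * (2 * e) <= t + s.
    by move: yj; rewrite -natr1; lra.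
  have je0 : 0 <= j%:R * (2 * e) by rewrite !mulr_ge0// ltW.
  have [||c1 [m [w [c2 [c'E Pu Pw]]]]] :=
    @chain_first_exit (fun w => mdist z w <= mdist z y + e) y c'.
  - by rewrite lerDl ltW.
  - by rewrite -ltNge (le_lt_trans _ out)//; lra.
  have [mn|nm] := leP m n.
    by right; apply: (heavy c2 m w c1) => //; lra.
  have {nm} nm : n + 1 <= m by rewrite -lezD1 in nm.
  rewrite -ltNge in Pw.
  move: yc'; rewrite c'E chain_cat /= => /andP[yc1 /andP[uw wc2]].
  have {}uw' : mdist (chain_end y c1) w <= e.
    exact: le_trans uw (r_noninc nm).
  have zw : mdist z w <= mdist z y + 2 * e.
    have := metric_triangle z (chain_end y c1) w; lra.
  have outE : chain_end y c' = chain_end w c2.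
    by rewrite c'E chain_end_cat.
  rewrite outE in out.
  (* The point [w] is still within the outer sphere, so the chain goes on after it. This makes the
     piece up to [w] short enough for the induction hypothesis. *)
  have c2n0 : (0 < size c2)%N.
    rewrite lt0n; apply/negP => /eqP/size0nil c20.
    by move: out; rewrite c20 /chain_end /= ltNge => /negP; apply; lra.
  move: c'k; rewrite c'E size_cat /= => c'k.
  rewrite -cat_rcons chain_cost_cat /chain_end /unzip2 map_rcons last_rcons -/(unzip2 _) /=.
  have first : W (n + 1) y / 2 <= chain_cost y (rcons c1 (m, w)).
    apply: IH.
    - rewrite size_rcons; apply: leq_trans c'k.
      by rewrite addnS ltnS -[X in (X < _)%N]addn0 ltn_add2l.
    - by rewrite -cats1 chain_cat yc1 /= uw.
    - rewrite /chain_end /unzip2 map_rcons last_rcons /= -/e.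
      have := metric_triangle z y w; lra.
  have flaty : lam * W n y <= W (n + 1) y by apply: flat; rewrite ty /=; lra.
  have Wy : W n x <= 2 * W n y by apply: inball; lra.
  have lamy : lam * W n x <= lam * (2 * W n y) by rewrite ler_pM2l.
  have [|||||h|h] := IHj c2 w.
  - apply: leq_trans c'k; rewrite addnS; apply: leqW; exact: leq_addl.
  - exact: wc2.
  - lra.
  - lra.
  - exact: out.
  - by left; rewrite -natr1; lra.
  - by right; have := chain_cost_ge0 y (rcons c1 (m, w)); lra.
have far' : t + s < mdist z (chain_end x c).
  have := metric_triangle x z (chain_end x c); rewrite (metric_sym x z); lra.
(* On leaving the inner ball the chain lands at most [e] beyond it; the extra piece in [J.+1]
   absorbs this. *)
have [||c1 [m [w [c2 [cE Pu Pw]]]]] :=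
  @chain_first_exit (fun w => mdist z w <= t) x c.
- exact: zx.
- by rewrite -ltNge; lra.
have [mn|nm] := leP m n.
  by apply: (heavy c2 m w c1) => //; lra.
rewrite -lezD1 in nm.
rewrite -ltNge in Pw.
move: xc far' ck; rewrite cE chain_cat chain_end_cat size_cat /=.
move=> /andP[xc1 /andP[uw wc2]] far' ck.
have uw' : mdist (chain_end x c1) w <= e by exact: le_trans uw (r_noninc nm).
have zw : mdist z w <= t + e.
  have := metric_triangle z (chain_end x c1) w; lra.
rewrite chain_cost_cat /=.
have h1 := chain_cost_ge0 x c1.
have h2 := W_gt0 m (chain_end x c1); have h3 := W_gt0 m w.
have JE : J%:R * (2 * e) + 2 * e <= s by move: Js; rewrite -natr1; lra.
have [|||||h|h] := pieces J c2 w.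
- move: ck; rewrite addnS !ltnS => ck.
  by apply: leq_trans ck; apply: leqW; exact: leq_addl.
- exact: wc2.
- exact: ltW.
- lra.
- exact: far'.
- have : 2 * W n x <= J%:R * lam * W n x by rewrite ler_pM2r.
  lra.
- lra.
Qed.

Hypothesis r_unbounded : forall a, exists n, a <= r n.
Hypothesis r_small : forall e, 0 < e -> exists n, r n < e.

Let chains x y := [set chain_cost x c | c in
  [set c | chain x c /\ chain_end x c = y]].

Let chains_lb x y : has_lbound (chains x y).
Proof. by exists 0 => _ [c _ <-]; exact: chain_cost_ge0. Qed.

(** One step at a coarse level joins any two points, so the infimum is taken over a nonempty set. *)
Let chains_inf x y : has_inf (chains x y).
Proof.
split; last exact: chains_lb.
have [n xy] := r_unbounded (mdist x y).
by exists (chain_cost x [:: (n, y)]); exists [:: (n, y)] => //=; rewrite xy.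
Qed.

Let chain_dist_le x c : chain x c -> chain_dist x (chain_end x c) <= chain_cost x c.
Proof. by move=> xc; apply: ge_inf; [exact: chains_lb|exists c]. Qed.

Let chain_dist_lb a x y :
  (forall c, chain x c -> chain_end x c = y -> a <= chain_cost x c) ->
  a <= chain_dist x y.
Proof.
move=> h; apply: lb_le_inf; first by case: (chains_inf x y).
by move=> _ [c [xc cy] <-]; exact: h.
Qed.

Lemma chain_dist_upper n x y : mdist x y <= r n -> chain_dist x y <= 3 * W n x.
Proof.
move=> xy; have /= := @chain_dist_le x [:: (n, y)].
rewrite xy addr0 => /(_ isT) h.
have : W n y <= 2 * W n x by apply: W_near; rewrite metric_sym.
rewrite /chain_end /= in h; lra.
Qed.

Lemma chain_dist_lower n x y : r n < mdist x y -> W n x / 2 <= chain_dist x y.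
Proof.
by move=> xy; apply: chain_dist_lb => c xc cy; apply: chain_cost_lower; rewrite ?cy.
Qed.

Lemma chain_dist_xx x : chain_dist x x = 0.
Proof.
apply/eqP; rewrite eq_le; apply/andP; split.
  exact: (@chain_dist_le x [::]).
by apply: chain_dist_lb => c _ _; exact: chain_cost_ge0.
Qed.

Lemma chain_dist_eq0 x y : chain_dist x y = 0 -> x = y.
Proof.
move=> xy0; apply/eqP; apply: contraPT xy0 => xy.
have xy0 : 0 < mdist x y by rewrite mdist_gt0.
have [n rn] := r_small xy0.
have := chain_dist_lower rn; have := W_gt0 n x => h1 h2 h3; lra.
Qed.

Lemma chain_dist_sym x y : chain_dist x y = chain_dist y x.
Proof.
wlog suff : x y / chain_dist x y <= chain_dist y x.
  by move=> h; apply/eqP; rewrite eq_le !h.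
apply: chain_dist_lb => c yc <-.
by have [c' [c'1 c'2 <-]] := chain_rev yc; rewrite -{2}c'2 chain_dist_le.
Qed.

Lemma chain_dist_triangle y x z :
  chain_dist x z <= chain_dist x y + chain_dist y z.
Proof.
rewrite -lerBlDr; apply: chain_dist_lb => c xc cy.
rewrite lerBlDr addrC -lerBlDr; apply: chain_dist_lb => c' yc' c'z.
rewrite lerBlDr addrC -{}c'z -{}cy in yc' *.
by rewrite -chain_cost_cat -chain_end_cat chain_dist_le// chain_cat xc.
Qed.

End chain_metric.

(** * Nets and shells in doubling spaces *)

(** With a power of two as the doubling constant, numbers of balls and powers of radii are compared
    through their exponents. *)
Definition doubling_exponent (R : realType) (X : metricType R) (D : nat) :=
  forall (x : X) (r : R), 0 < r -> exists2 c : seq X, (size c <= 2 ^ D)%N &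
    ball x r `<=` \bigcup_(y in [set` c]) ball y (r / 2).

Section doubling.
Context {R : realType} {X : metricType R}.
Variable D : nat.
Hypothesis doublingD : doubling_exponent X D.

Lemma doubling_iter k (x : X) (r : R) : 0 < r ->
  exists2 c : seq X, (size c <= 2 ^ (D * k))%N &
    ball x r `<=` \bigcup_(y in [set` c]) ball y (r / 2 ^+ k).
Proof.
move=> r0; elim: k => [|k [c ck cov]].
  exists [:: x]; first by rewrite muln0.
  by rewrite expr0 divr1 => y xy; exists x => //=; rewrite mem_head.
have [c' c'k c'cov] : exists2 c' : seq X, (size c' <= size c * 2 ^ D)%N &
    \bigcup_(y in [set` c]) ball y (r / 2 ^+ k) `<=`
    \bigcup_(y in [set` c']) ball y (r / 2 ^+ k / 2).
  elim: {ck cov}c => [|a c [c' c'k c'cov]].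
    by exists [::] => // y [z /=]; rewrite inE.
  have [|c1 c1D c1cov] := @doublingD a (r / 2 ^+ k).
    by rewrite divr_gt0// exprn_gt0.
  exists (c1 ++ c'); first by rewrite size_cat mulSn leq_add.
  move=> y [z /=]; rewrite in_cons => /orP[/eqP->|zc] yz.
    by have [w /= wc yw] := c1cov _ yz; exists w => //=; rewrite mem_cat wc.
  have [|w /= wc yw] := c'cov y; first by exists z.
  by exists w => //=; rewrite mem_cat wc orbT.
exists c'.
  by rewrite (leq_trans c'k)// mulnS addnC expnD leq_mul2r ck orbT.
by rewrite exprSr invfM mulrA => y /cov /c'cov.
Qed.

Definition separated (e : R) (Z : set X) :=
  forall z z', Z z -> Z z' -> z != z' -> e <= mdist z z'.

(** Two points in the same covering ball of radius [r / 2 ^+ k] are less than [e] apart, so each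
    covering ball holds at most one point of [s]. *)
Lemma separated_packing k (x : X) (r e : R) (Z : set X) (s : seq X) :
  0 < r -> 2 * r / 2 ^+ k <= e -> separated e Z ->
  uniq s -> (forall z, z \in s -> Z z /\ ball x r z) ->
  (size s <= 2 ^ (D * k))%N.
Proof.
move=> r0 re Zsep us sZ.
have [c ck cov] := doubling_iter k x r0.
have /choice [f fP] : forall z, exists y, z \in s -> y \in c /\ ball y (r / 2 ^+ k) z.
  move=> z; have [zs|] := boolP (z \in s); last by exists x.
  by have [y yc yz] := cov _ (sZ _ zs).2; exists y.
rewrite (leq_trans _ ck)// -(size_map f s); apply: uniq_leq_size; last first.
  by move=> _ /mapP[z zs ->]; exact: (fP z zs).1.
rewrite map_inj_in_uniq// => z z' zs z's ff.
apply/eqP; apply: contraPT isT => zz'.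
have := Zsep _ _ (sZ _ zs).1 (sZ _ z's).1 zz'.
have := (fP _ zs).2; have := (fP _ z's).2; rewrite -ff !ballEmdist /=.
have := metric_triangle z (f z) z'; rewrite (metric_sym z (f z)) => h1 h2 h3 h4.
by move: re; rewrite -mulrA => re; lra.
Qed.

(** Zorn's lemma: a point at distance at least [e] from a maximal separated set could be added to
    it. *)
Lemma maximal_separated (e : R) : exists2 Z : set X, separated e Z &
  forall x, 0 < e -> exists2 z, Z z & mdist z x < e.
Proof.
have [F FP Ftot|Z [Zsep Zmax]] := @Zorn_bigcup X (separated e).
  move=> z z' [A FA Az] [B FB Bz'] zz'.
  by have [AB|BA] := Ftot A B FA FB;
    [apply: (FP _ FB) => //; apply: AB|apply: (FP _ FA) => //; apply: BA].
exists Z => // x e0; apply: contrapT => nZ.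
have far z : Z z -> e <= mdist z x.
  by move=> Zz; rewrite leNgt; apply/negP => zx; apply: nZ; exists z.
apply: (Zmax (Z `|` [set x])).
  split; first by move=> y; left.
  move=> /(_ x (or_intror erefl)) Zx.
  by have := far _ Zx; rewrite mdistxx leNgt e0.
move=> z z' [Zz|->] [Zz'|->] zz'; first exact: Zsep.
- exact: far.
- by rewrite metric_sym; exact: far.
- by rewrite eqxx in zz'.
Qed.

End doubling.

(** * Lipschitz functions equal to 1 on shells *)

Lemma clamp_le_add {R : realFieldType} (a u v w : R) : 0 <= w -> u <= v + w ->
  Num.max a (Num.min 1 u) <= Num.max a (Num.min 1 v) + w.
Proof.
move=> w0 uvw; rewrite ge_max ler_wpDr ?le_max ?lexx//=.
rewrite -lerBlDr le_max; apply/orP; right; rewrite lerBlDr.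
by case: (leP 1 u); case: (leP 1 v); lra.
Qed.

Section shell_function.
Context {R : realType} {X : metricType R}.
Variables (Z : set X) (t s : R).
Hypothesis s_gt0 : 0 < s.
Hypothesis Z_neq0 : Z !=set0.

(** A clamped tent: [1] where [mdist z x] is within [s] of [t], [8^-1] where it differs from [t] by
    at least [2 * s], and Lipschitz with constant [1 / s]. *)
Let bump (z x : X) : R :=
  Num.max (8^-1) (Num.min 1 (2 - `|mdist z x - t| / s)).

Definition shell_function (x : X) : R := sup [set bump z x | z in Z].

Let bump_ge z x : 8^-1 <= bump z x.
Proof. by rewrite le_max lexx. Qed.

Let bump_le1 z x : bump z x <= 1.
Proof. by rewrite ge_max ge_min lexx /=; lra. Qed.

Let bumps_sup x : has_sup [set bump z x | z in Z].
Proof.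
have [z Zz] := Z_neq0.
by split; [exists (bump z x), z|exists 1 => _ [w _ <-]; exact: bump_le1].
Qed.

Let le_shell_function z x : Z z -> bump z x <= shell_function x.
Proof. by move=> Zz; apply: ub_le_sup; [exact: (bumps_sup x).2|exists z]. Qed.

Let shell_function_le x a : (forall z, Z z -> bump z x <= a) ->
  shell_function x <= a.
Proof.
by move=> h; apply: ge_sup; [exact: (bumps_sup x).1|move=> _ [z Zz <-]; exact: h].
Qed.

Lemma shell_function_ge x : 8^-1 <= shell_function x.
Proof. by have [z Zz] := Z_neq0; apply: le_trans (le_shell_function x Zz). Qed.

Lemma shell_function_le1 x : shell_function x <= 1.
Proof. exact: shell_function_le. Qed.

Lemma shell_function_lipschitz x y :
  shell_function x <= shell_function y + mdist x y / s.
Proof.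
apply: shell_function_le => z Zz.
have : bump z x <= bump z y + mdist x y / s.
  have d0 : 0 <= mdist x y / s by rewrite divr_ge0// ?mdist_ge0// ltW.
  have key : 2 - `|mdist z x - t| / s <= 2 - `|mdist z y - t| / s + mdist x y / s.
    rewrite -subr_ge0.
    suff -> : 2 - `|mdist z y - t| / s + mdist x y / s -
       (2 - `|mdist z x - t| / s) =
       (mdist x y + `|mdist z x - t| - `|mdist z y - t|) / s.
      apply: divr_ge0; last exact: ltW.
      have h1 : mdist z y <= mdist z x + mdist x y by exact: metric_triangle.
      have h2 : mdist z x <= mdist z y + mdist x y.
        by rewrite (metric_sym x y); exact: metric_triangle.
      have := ler_norm (mdist z x - t).
      have := ler_norm (- (mdist z x - t)); rewrite normrN.
      case: (ger0P (mdist z y - t)); lra.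
    by field; rewrite gt_eqF.
  exact: clamp_le_add.
by move=> /le_trans; apply; rewrite lerD2r le_shell_function.
Qed.

Lemma shell_function_eq1 z x : Z z -> `|mdist z x - t| <= s ->
  shell_function x = 1.
Proof.
move=> Zz zx; apply/eqP; rewrite eq_le shell_function_le1 /=.
apply: le_trans (le_shell_function x Zz).
rewrite /bump le_max; apply/orP; right; rewrite le_min lexx /=.
by have : `|mdist z x - t| / s <= 1 by [rewrite ler_pdivrMr// mul1r]; lra.
Qed.

Lemma shell_function_gt x : 8^-1 < shell_function x ->
  exists2 z, Z z & `|mdist z x - t| < 2 * s.
Proof.
move=> x8; apply: contrapT => nZ; move: x8; rewrite ltNge => /negP; apply.
apply: shell_function_le => z Zz; rewrite /bump ge_max lexx /= ge_min.
apply/orP; right.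
have : 2 * s <= `|mdist z x - t|.
  by rewrite leNgt; apply/negP => h; apply: nZ; exists z.
by rewrite -ler_pdivlMr// => h; lra.
Qed.

End shell_function.

(** Call [c] bad at [x] if [chi c x] exceeds [8^-1]. Then some net point has its distance to [x]
    within [2 * s] of [t c]. These windows are disjoint for different [c], so different bad [c] have
    different net points, and packing leaves at most [K / 8] bad [c]. *)
Lemma shell_family (R : realType) (X : metricType R) (D : nat)
    (doublingD : doubling_exponent X D)
    (K := (8 * 2 ^ (D * 2))%N) (p : X) (s : R) : 0 < s ->
  let r := 512 * (2 ^ (D * 2))%:R * s in
  exists chi : nat -> X -> R,
  [/\ forall c x, 8^-1 <= chi c x <= 1,
      forall c x y, chi c x <= chi c y + mdist x y / s,
      forall c x, (c < K)%N -> exists z t, [/\ mdist z x <= t, 4 * (t + s) <= r &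
        forall w, t <= mdist z w <= t + s -> chi c w = 1] &
      forall x, \sum_(c < K) chi c x <= K%:R / 4].
Proof.
move=> s0 r; set T := (2 ^ (D * 2))%:R : R in r *.
have KT : K%:R = 8 * T by rewrite /K natrM.
have T0 : 1 <= T by rewrite /T ler1n expn_gt0.
have Ts : s <= T * s by rewrite ler_pMl.
have r0 : 0 < r by rewrite /r !mulr_gt0//; lra.
have [Z Zsep Znet] := maximal_separated (X := X) (r / 16).
have Z0 : Z !=set0 by have [|z Zz _] := Znet p; [lra|exists z].
(* Starting at [r / 16] puts some net point within [t c] of any [x]. The [K] windows of width
   [4 * s] take up [8 * T * (4 * s) = r / 16], which explains the [512] and keeps all radii below
   [r / 8]. *)
pose t (c : nat) := r / 16 + c%:R * (4 * s).
have tK c : (c < K)%N -> t c + 4 * s <= r / 8.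
  rewrite -(ler_nat R) -natr1 KT => cK.
  have : (c%:R + 1) * (4 * s) <= 8 * T * (4 * s) by rewrite ler_pM2r//; lra.
  by rewrite /t /r; lra.
exists (fun c => shell_function Z (t c) s); split.
- by move=> c x; rewrite shell_function_ge// shell_function_le1.
- by move=> c x y; exact: shell_function_lipschitz.
- move=> c x cK; have [|z Zz zx] := Znet x; first lra.
  exists z, (t c); split.
  + have : 0 <= c%:R * (4 * s) by rewrite mulr_ge0//; lra.
    by rewrite /t; lra.
  + have := tK c cK; lra.
  + move=> w zw; apply: (@shell_function_eq1 _ _ _ _ _ s0 Z0 z) => //.
    by rewrite ler_norml; lra.
move=> x.
have /choice [f fP] : forall c, exists z, 8^-1 < shell_function Z (t c) s x ->
    Z z /\ `|mdist z x - t c| < 2 * s.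
  move=> c; have [|] := pselect (8^-1 < shell_function Z (t c) s x).
    by move=> /(shell_function_gt s0 Z0)[z]; exists z.
  by exists p.
pose bad := [seq c <- iota 0 K | 8^-1 < shell_function Z (t c) s x].
have badP c : c \in bad -> [/\ (c < K)%N, Z (f c) & `|mdist (f c) x - t c| < 2 * s].
  by rewrite mem_filter mem_iota /= add0n => /andP[/fP[]].
have bad_size : (size bad <= 2 ^ (D * 2))%N.
  (* Two halvings suffice: [2 * (r / 8) / 2 ^+ 2] is the separation [r / 16] of the net. *)
  rewrite -(size_map f); apply: (separated_packing (x := x) (r := r / 8) doublingD _ _ Zsep).
  - lra.
  - by rewrite expr2; lra.
  - rewrite map_inj_in_uniq; first by rewrite filter_uniq// iota_uniq.
    (* A net point shared by [c] and [c'] would give radii less than [4 * s] apart, the spacing of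
       the [t c]. *)
    move=> c c' /badP[_ _ h1] /badP[_ _ h2] ff; rewrite -ff in h2.
    have : `|t c - t c'| < 1 * (4 * s).
      move: h1 h2; rewrite !ltr_norml; lra.
    have -> : t c - t c' = (c%:R - c'%:R) * (4 * s) by rewrite /t; ring.
    rewrite normrM (gtr0_norm (_ : 0 < 4 * s)); last lra.
    rewrite ltr_pM2r; last lra.
    have -> : c%:R - c'%:R = (c%:Z - c'%:Z)%:~R :> R by rewrite intrB.
    rewrite -intr_norm -[1](@mulr1z R) ltr_int => h.
    apply/eqP; rewrite -(eqr_nat int); apply/eqP; move: h; lia.
  - move=> _ /mapP[c /badP[cK Zf fc] ->]; split=> //.
    rewrite ballEmdist /= metric_sym; move: fc; rewrite ltr_norml.
    have := tK c cK; lra.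
(* Every [c] contributes [8^-1], in total [K / 8 = T], and each of the at most [T] bad ones adds at
   most [1]. *)
have -> : K%:R / 4 = \sum_(c < K) 8^-1 + T.
  by rewrite sumr_const card_ord -mulr_natl KT; lra.
apply: (@le_trans _ _ (\sum_(c < K) (8^-1 +
    (8^-1 < shell_function Z (t c) s x)%R%:R))).
  apply: ler_sum => c _; case: ltP => //=.
    by move=> _; apply: (le_trans (shell_function_le1 _ _ Z0 x)); lra.
  by rewrite addr0.
rewrite big_split /= lerD2l.
rewrite -(big_mkord xpredT (fun c => (8^-1 < shell_function Z (t c) s x)%R%:R)).
rewrite -natr_sum ler_nat (leq_trans _ bad_size)// size_filter -sum1_count.
by rewrite /index_iota subn0 [in leqRHS]big_mkcond /= leq_sum// => c _; case: ifP.
Qed.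

(** * Borel measures on doubling spaces *)

Lemma metric_ball_open (R : realType) (X : metricType R) (x : X) (e : R) :
  open (ball x e).
Proof.
rewrite openE /= /interior => y; rewrite ballEmdist /= => xy.
rewrite -nbhs_ballE; exists (e - mdist x y) => /=; first by rewrite subr_gt0.
move=> z; rewrite !ballEmdist /= => yz.
by have := metric_triangle x y z; lra.
Qed.

(** A Lindelof property: finite covers of the balls [ball p n.+1%:R] by ever smaller balls form a
    countable family, and every point of [A] lies in a member small enough to inherit [P]. *)
Lemma doubling_lindelof (R : realType) (X : metricType R) (D : nat)
    (doublingD : doubling_exponent X D)
    (p : X) (P : set (set X)) (A : set X) :
  P set0 -> (forall U V, open U -> U `<=` V -> P V -> P U) ->
  (forall x, A x -> exists2 U, open_nbhs x U & P U) ->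
  exists U : nat -> set X,
    [/\ forall i, open (U i), forall i, P (U i) & A `<=` \bigcup_i U i].
Proof.
move=> P0 Psub AP.
have /choice [c cP] : forall nk : nat * nat, exists c : seq X,
    ball p nk.1.+1%:R `<=` \bigcup_(y in [set` c]) ball y (nk.1.+1%:R / 2 ^+ nk.2).
  by move=> [n k]; have [|c _ cc] := @doubling_iter _ _ _ doublingD k p n.+1%:R;
    [rewrite ltr0n|exists c].
pose B (i : nat * nat * nat) : set X := ball (nth p (c i.1) i.2) (i.1.1.+1%:R / 2 ^+ i.1.2).
(* Indices that code no ball, or a ball without [P], are filled with the empty set; [P set0] is
   needed for them. *)
pose U (i : nat) : set X := if unpickle i is Some j then
  if pselect (P (B j)) then B j else set0 else set0.
exists U; split.
- move=> i; rewrite /U; case: unpickle => [j|]; last exact: open0.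
  by case: pselect => ?; [exact: metric_ball_open|exact: open0].
- by move=> i; rewrite /U; case: unpickle => [j|//]; case: pselect.
move=> x /AP [V [oV Vx] PV].
have : nbhs x V by exact: open_nbhs_nbhs.
rewrite -nbhs_ballE => -[e /= e0 eV].
set n := Num.Def.truncn (mdist p x).
have pn : ball p n.+1%:R x by rewrite ballEmdist /= truncnS_gt.
(* Through [m < 2 ^ m], this [k] makes twice the radius of the covering balls less than [e]. *)
set k := Num.Def.truncn (e^-1 * (2 * n.+1%:R)).
have ke : n.+1%:R / 2 ^+ k.+1 * 2 < e.
  rewrite mulrAC ltr_pdivrMr ?exprn_gt0// mulrC -ltr_pdivrMl//.
  apply: lt_trans (truncnS_gt _) _;
  by rewrite -natrX ltr_nat ltn_expl.
have [z /= zc zx] := cP (n, k.+1) x pn.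
have BV : ball z (n.+1%:R / 2 ^+ k.+1) `<=` V.
  move=> y zy; apply: eV; move: zx zy; rewrite !ballEmdist /= (metric_sym z x).
  by have := metric_triangle x z y; lra.
exists (pickle (n, k.+1, index z (c (n, k.+1)))) => //.
rewrite /U pickleK; case: pselect => [?|[]] /=; rewrite /B /= nth_index//.
exact: Psub (metric_ball_open _ _) BV PV.
Qed.

Section borel_measure.
Context {R : realType} {X : pmetricType R}.
Local Notation BX := (g_sigma_algebraType (@open X)).

Lemma open_borel (U : set X) : open U -> measurable (U : set BX).
Proof. by move=> oU; exact: sub_sigma_algebra. Qed.

Lemma closed_borel (A : set X) : closed A -> measurable (A : set BX).
Proof.
move=> cA; rewrite -(setCK A); apply: measurableC; apply: open_borel.
exact: closed_openC.
Qed.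

Lemma continuous_borel_measurable (f : X -> R) : continuous f ->
  measurable_fun [set: BX] f.
Proof.
move=> /continuousP cf; apply: (measurability _ (RGenOpens.measurableE R)).
move=> _ [_ [a [b ->] <-]]; rewrite setTI; apply: open_borel.
exact/cf/interval_open.
Qed.

Local Open Scope ereal_scope.

(** Sum the restrictions of [mu] to the [U i], weighted so that the [i]-th has mass at most
    [2 ^- i.+1]; the [1 +] in the denominator avoids division by zero. All weights are positive, so
    a [nu]-null set meets each [U i] in a [mu]-null set. *)
Lemma finite_dominating_measure (mu : borel_measure X R) (U : nat -> set X) :
  (forall i, open (U i)) -> (forall i, mu (U i) < +oo) ->
  [set: X] `<=` \bigcup_i U i ->
  exists2 nu : borel_measure X R, nu [set: X] < +oo &
    forall A, nu.-negligible A -> mu.-negligible A.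
Proof.
move=> oU fU UX.
have mU i : measurable (U i : set BX) by exact: open_borel.
have w0 i : (0 <= (2 ^ i.+1)%:R^-1 / (1 + fine (mu (U i))))%R.
  by rewrite divr_ge0// ?invr_ge0// addr_ge0// fine_ge0.
pose m i : borel_measure X R := mscale (NngNum (w0 i)) (mrestr mu (mU i)).
have mE i B : m i B =
    ((2 ^ i.+1)%:R^-1 / (1 + fine (mu (U i))))%:E * mu (B `&` U i) by [].
exists (mseries m 0).
  apply: (@le_lt_trans _ _ 1%:E); last exact: ltry.
  apply: le_trans (@epsilon_trick0 R 1 xpredT ler01).
  apply: lee_nneseries => [//|i _].
  rewrite mE setTI -[X in _ * X](@fineK _ (mu (U i))); last first.
    by rewrite ge0_fin_numE.
  rewrite -EFinM lee_fin div1r -mulrA ler_piMr// ?invr_ge0//.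
  by rewrite mulrC ler_pdivrMr ?mul1r ?ler_wpDl// ltr_pwDl// fine_ge0.
move=> A [B [mB B0 AB]].
apply: (@negligibleS _ _ _ _ (\bigcup_i (B `&` U i))).
  by move=> x /AB Bx; have [//|i _ Ux] := UX x; exists i.
apply: negligible_bigcup => i; exists (B `&` U i); split => //.
  exact: measurableI.
have w_gt0 : (0 < (2 ^ i.+1)%:R^-1 / (1 + fine (mu (U i))))%R.
  by rewrite divr_gt0// ?invr_gt0 ?ltr0n ?expn_gt0// ltr_pwDl// fine_ge0.
have : m i B <= 0.
  rewrite -B0 /mseries; apply: le_trans (nneseries_lim_ge i.+1 _) => //.
  by rewrite big_nat_recr//= leeDr// sume_ge0.
rewrite mE => mB0; apply/eqP.
have : ((2 ^ i.+1)%:R^-1 / (1 + fine (mu (U i))))%:E * mu (B `&` U i) == 0.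
  by rewrite eq_le mB0 mule_ge0// lee_fin w0.
by rewrite mule_eq0 eqe gt_eqF.
Qed.

(** * Averaging over choices and null sets *)

Lemma bounded_integral_fin_num (nu : borel_measure X R) (V : X -> R) :
  nu [set: X] < +oo -> continuous V -> (forall x, 0 <= V x <= 1)%R ->
  \int[nu]_x (V x)%:E \is a fin_num.
Proof.
move=> nuoo cV V01; rewrite ge0_fin_numE; last first.
  by apply: integral_ge0 => x _; rewrite lee_fin; case/andP: (V01 x).
apply: le_lt_trans nuoo; rewrite -[leRHS]mul1e -integral_cst//.
apply: ge0_le_integral => //.
- by move=> x _; rewrite lee_fin; case/andP: (V01 x).
- apply/measurable_EFinP; exact: continuous_borel_measurable.
- by move=> x _; rewrite /= lee_fin; case/andP: (V01 x).
Qed.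

(** If every [c] failed, summing the [K] integrals would give more than [K / 4] times the integral
    of [V], against the pointwise bound on the sum of the [chi c]. *)
Lemma integral_pigeonhole (nu : borel_measure X R) (V : X -> R) (K : nat)
    (chi : nat -> X -> R) :
  nu [set: X] < +oo -> continuous V -> (forall x, 0 <= V x <= 1)%R ->
  (0 < K)%N -> (forall c, continuous (chi c)) ->
  (forall c x, 0 <= chi c x)%R ->
  (forall x, \sum_(c < K) chi c x <= K%:R / 4)%R ->
  exists2 c, (c < K)%N &
    \int[nu]_x (V x * chi c x)%:E <= 4^-1%:E * \int[nu]_x (V x)%:E.
Proof.
move=> nuoo cV V01 K0 cchi chi0 chiK; set I := integral _ _ _.
have If : I \is a fin_num by exact: bounded_integral_fin_num.
have V0 x : (0 <= V x)%R by case/andP: (V01 x).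
apply: contrapT => nc.
have {nc} lt c : (c < K)%N -> 4^-1%:E * I < \int[nu]_x (V x * chi c x)%:E.
  by move=> cK; rewrite ltNge; apply/negP => h; apply: nc; exists c.
have mV : measurable_fun [set: g_sigma_algebraType (@open X)] V.
  exact: continuous_borel_measurable.
have mchi c : measurable_fun [set: g_sigma_algebraType (@open X)] (chi c).
  exact: continuous_borel_measurable.
have : \sum_(c < K) \int[nu]_x (V x * chi c x)%:E <= (K%:R / 4)%:E * I.
  rewrite -ge0_integral_sum//=; last 2 first.
  - by move=> c; apply/measurable_EFinP; exact: measurable_funM.
  - by move=> c x _; rewrite lee_fin mulr_ge0.
  rewrite -ge0_integralZl//=; last 2 first.
  - by apply/measurable_EFinP.
  - by move=> x _; rewrite lee_fin.
  apply: ge0_le_integral => //=.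
  - by move=> x _; rewrite sume_ge0// => c _; rewrite lee_fin mulr_ge0.
  - apply: emeasurable_sum => c; apply/measurable_EFinP.
    exact: measurable_funM.
  - apply/measurable_EFinP; exact: measurable_funM.
  - move=> x _; rewrite sumEFin lee_fin -mulr_sumr mulrC.
    by rewrite ler_wpM2r.
apply/negP; rewrite -ltNge.
have -> : (K%:R / 4)%:E * I = \sum_(c < K) (4^-1%:E * I).
  rewrite -(fineK If) -EFinM -EFinM sumEFin sumr_const card_ord.
  by congr EFin; rewrite -mulr_natr; ring.
case: K K0 lt {chiK} => // K _ lt.
rewrite [ltLHS]big_ord_recl [ltRHS]big_ord_recl.
apply: lte_leD; last 2 first.
- exact: lt.
- by apply: lee_sum => c _; apply: ltW; exact: lt.
by rewrite -(fineK If) -EFinM sumEFin.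
Qed.

(** The integral of [V n] is at most [M * 4 ^- n], while [V n] is at least [2 ^- n] on the set. By
    Markov's inequality the set has measure at most [M * 2 ^- n] for all [n >= k]. *)
Lemma geometric_integral_null (nu : borel_measure X R) (V : nat -> X -> R) (k : nat) :
  nu [set: X] < +oo -> (forall n, continuous (V n)) ->
  (forall n x, 0 <= V n x <= 1)%R ->
  (forall n, \int[nu]_x (V n.+1 x)%:E <= 4^-1%:E * \int[nu]_x (V n x)%:E) ->
  nu.-negligible [set x | forall n, (k <= n)%N -> (2 ^- n <= V n x)%R].
Proof.
move=> nuoo cV V01 int4.
pose A := [set x | forall n, (k <= n)%N -> (2 ^- n <= V n x)%R].
have V0 n x : (0 <= V n x)%R by case/andP: (V01 n x).
have mVn n : measurable_fun [set: g_sigma_algebraType (@open X)] (V n).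
  exact: continuous_borel_measurable.
pose F n : set (g_sigma_algebraType (@open X)) := [set x | (2 ^- n <= V n x)%R].
have mF n : measurable (F n).
  rewrite /F -[X in measurable X]setTI.
  have -> : [set x | (2 ^- n <= V n x)%R] = V n @^-1` `[2 ^- n, +oo[%classic.
    by apply/seteqP; split => x /=; rewrite in_itv /= andbT.
  exact: mVn.
have AE : A = \bigcap_(n in [set n | (k <= n)%N]) F n by [].
have mA : measurable (A : set (g_sigma_algebraType (@open X))).
  rewrite AE; apply: bigcap_measurable => [|n _]; [by exists k => /=|exact: mF].
set M := fine (\int[nu]_x (V 0%N x)%:E).
have IV n : \int[nu]_x (V n x)%:E <= (M * 4 ^- n)%:E.
  elim: n => [|n IH].
    by rewrite expr0 invr1 mulr1 fineK// bounded_integral_fin_num.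
  apply: le_trans (int4 n) _.
  apply: (@le_trans _ _ (4^-1%:E * (M * 4 ^- n)%:E)).
    by apply: lee_wpmul2l => //; rewrite lee_fin invr_ge0.
  by rewrite -EFinM lee_fin exprS invfM mulrCA.
have nuA : nu A \is a fin_num.
  rewrite ge0_fin_numE//; apply: le_lt_trans nuoo.
  by apply: le_measure => //; rewrite inE//; exact: measurableT.
have bound n : (k <= n)%N -> (fine (nu A) <= M * 2 ^- n)%R.
  move=> kn.
  have : (2 ^- n)%:E * nu A <= (M * 4 ^- n)%:E.
    apply: le_trans (IV n).
    apply: (@le_trans _ _ (\int[nu]_(x in A) (V n x)%:E)).
      rewrite -integral_cst//; apply: ge0_le_integral => //=.
      - by apply/measurable_EFinP; exact: measurable_funTS.
      - by move=> x Ax; rewrite lee_fin; apply: Ax.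
    apply: ge0_subset_integral => //=.
    - by apply/measurable_EFinP.
    - by move=> x _; rewrite lee_fin.
  rewrite -(fineK nuA) -EFinM lee_fin.
  rewrite (_ : 4 = 2 * 2 :> R)%R; last by rewrite -natrM.
  rewrite exprMn invfM mulrCA ler_pM2l// invr_gt0 exprn_gt0//.
exists A; split => //.
apply/eqP; rewrite -(fineK nuA) eqe eq_le fine_ge0// andbT.
rewrite leNgt; apply/negP => pos.
have M0 : (0 < M)%R.
  have := bound k (leqnn k) => /(lt_le_trans pos).
  by rewrite pmulr_lgt0// invr_gt0 exprn_gt0.
set j := Num.Def.truncn (M / fine (nu A)).
have := bound (maxn k j.+1) (leq_maxl _ _).
apply/negP; rewrite -ltNge ltr_pdivrMr ?exprn_gt0//.
rewrite mulrC -ltr_pdivrMr//; apply: (lt_trans (truncnS_gt _)).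
rewrite -natrX ltr_nat -/j; apply: (@leq_trans (2 ^ j.+1)); first exact: ltn_expl.
by rewrite leq_exp2l// leq_maxr.
Qed.
End borel_measure.

(** * The weights *)

Definition shell_weight (R : realType) (X : metricType R) (r s : R)
    (chi : X -> R) :=
  [/\ forall x, 8^-1 <= chi x <= 1,
      forall x y, chi x <= chi y + mdist x y / s &
      forall x, exists z t, [/\ mdist z x <= t, 4 * (t + s) <= r &
        forall w, t <= mdist z w <= t + s -> chi w = 1]].

Lemma lipschitz_continuous (R : realType) (X : metricType R) (s : R)
    (chi : X -> R) : 0 < s ->
  (forall x y, chi x <= chi y + mdist x y / s) -> continuous chi.
Proof.
move=> s0 lip x; apply/cvgrPdist_lt => e e0.
apply/nbhs_ballP; exists (e * s) => /=; first by rewrite mulr_gt0.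
move=> y; rewrite ballEmdist /= -ltr_pdivrMr// => xy.
have := lip x y; have := lip y x; rewrite (metric_sym y x) => h1 h2.
by rewrite ltr_norml; lra.
Qed.

Lemma weight_sequence (R : realType) (X : pmetricType R) (D : nat)
    (doublingD : doubling_exponent X D)
    (nu : borel_measure X R) (s : nat -> R) :
  (nu [set: X] < +oo)%E -> (forall n, 0 < s n) ->
  exists V chi : nat -> X -> R,
  [/\ forall x, V 0 x = 1,
      forall n x, V n.+1 x = V n x * chi n x,
      forall n, shell_weight (512 * (2 ^ (D * 2))%:R * s n) (s n) (chi n) &
      forall k, nu.-negligible [set x | forall n, (k <= n)%N -> 2 ^- n <= V n x]].
Proof.
move=> nuoo s0.
(* The choice is made for all pairs [(n, V)] at once, with an arbitrary value for unsuitable [V]. It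
   can then be iterated first, and suitability of each [V n] proved afterwards. *)
have /choice [f fP] : forall nV : nat * (X -> R), exists chi : X -> R,
    continuous nV.2 /\ (forall x, 0 <= nV.2 x <= 1) ->
    shell_weight (512 * (2 ^ (D * 2))%:R * s nV.1) (s nV.1) chi /\
    (\int[nu]_x (nV.2 x * chi x)%:E <= 4^-1%:E * \int[nu]_x (nV.2 x)%:E)%E.
  move=> [n V] /=.
  have [[cV V01]|] := pselect (continuous V /\ forall x, 0 <= V x <= 1); last first.
    by move=> nV; exists V.
  have [chi [chi81 chilip chishell chisum]] := shell_family doublingD point (s0 n).
  have [|||c cK cint] := @integral_pigeonhole _ _ nu V _ chi nuoo cV V01 _ _ _ chisum.
  - by rewrite muln_gt0 expn_gt0.
  - by move=> c; exact: lipschitz_continuous (chilip c).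
  - by move=> c x; have /andP[+ _] := chi81 c x; apply: le_trans; rewrite invr_ge0.
  by exists (chi c) => _; split=> //; split=> // x; exact: chishell.
pose V := fix V n := if n is m.+1 then fun x => V m x * f (m, V m) x else fun=> 1.
have VP n : continuous (V n) /\ (forall x, 0 <= V n x <= 1).
  elim: n => [|n [cV V01]] /=.
    by split=> [x|x]; [exact: cst_continuous|rewrite ler01 lexx].
  have [/= [chi81 chilip _] _] := fP (n, V n) (conj cV V01).
  split=> [x|x].
    apply: continuousM; first exact: cV.
    by apply: lipschitz_continuous chilip x.
  have /andP[V0 V1] := V01 x; have /andP[c8 c1] := chi81 x.
  have c0 : 0 <= f (n, V n) x by apply: le_trans c8; rewrite invr_ge0.
  by rewrite mulr_ge0//= mulr_ile1.
exists V, (fun n => f (n, V n)); split=> //.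
  by move=> n; exact: (fP (n, V n) (VP n)).1.
move=> k; apply: geometric_integral_null => // n; [exact: (VP n).1|exact: (VP n).2|].
exact: (fP (n, V n) (VP n)).2.
Qed.

Lemma bernoulli_le (R : realFieldType) (u : R) (B : nat) : 0 <= u <= 1 ->
  1 - B%:R * u <= (1 - u) ^+ B.
Proof.
move=> /andP[u0 u1]; elim: B => [|B IH]; first by rewrite mul0r subr0 expr0.
have B0 : 0 <= B%:R * (u * u) by rewrite !mulr_ge0.
have : (1 - B%:R * u) * (1 - u) <= (1 - u) ^+ B * (1 - u).
  by rewrite ler_wpM2r ?subr_ge0.
by rewrite -exprSr -natr1; lra.
Qed.

(** * Geometric scales *)

Section scale.
Context {R : realType}.
Variable l : nat.
Hypothesis l_gt0 : (0 < l)%N.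

(** Negative levels give the large scales, by which any two points of an unbounded space can be
    joined. *)
Definition scale (n : int) : R := (4 ^+ l) ^ (- n).

Let M1 : (1 : R) < 4 ^+ l.
Proof. by rewrite exprn_egt1 ?ltr1n// -lt0n. Qed.

Let M0 : (0 : R) < 4 ^+ l.
Proof. exact: lt_trans M1. Qed.

Lemma scale_gt0 n : 0 < scale n.
Proof. exact: exprz_gt0. Qed.

Lemma scale_noninc (n m : int) : n <= m -> scale m <= scale n.
Proof. by move=> nm; rewrite ler_eXz2l// lerN2. Qed.

Lemma scaleS n : scale n = 4 ^+ l * scale (n + 1).
Proof.
by rewrite /scale opprD expfzDr ?gt_eqF// mulrCA exprN1 mulfV ?mulr1// gt_eqF.
Qed.

Lemma scale_small (e : R) : 0 < e -> exists n : nat, scale n < e.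
Proof.
move=> e0; exists (Num.Def.truncn e^-1).+1.
rewrite /scale -exprnN invf_plt ?posrE ?exprn_gt0//.
apply: (lt_trans (truncnS_gt _)).
rewrite -exprM -natrX ltr_nat; apply: (leq_ltn_trans (leq_pmull _ l_gt0)).
exact: ltn_expl.
Qed.

Lemma scale_unbounded (a : R) : exists n : nat, a <= scale (- n%:Z).
Proof.
exists (Num.Def.truncn a).+1; rewrite /scale opprK -exprnP.
apply: ltW; apply: (lt_trans (truncnS_gt _)).
rewrite -exprM -natrX ltr_nat; apply: (leq_ltn_trans (leq_pmull _ l_gt0)).
exact: ltn_expl.
Qed.

Lemma scale_level (t : R) : 0 < t -> exists n : int, scale (n + 1) < t <= scale n.
Proof.
move=> t0; have [k tk] := scale_small t0; have [j tj] := scale_unbounded t.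
have : t <= scale (k%:Z - (k + j)%:Z) by rewrite PoszD opprD addrA subrr sub0r.
(* A search from the coarse level [-j] down to the fine level [k] for the first scale below [t]. *)
elim: {tj}(k + j)%N => [|i IH] h; first by move: tk; rewrite ltNge -[k%:Z]subr0 h.
have [/IH//|lt] := leP t (scale (k%:Z - i%:Z)).
exists (k%:Z - i.+1%:Z); rewrite h andbT.
by rewrite (_ : _ + 1 = k%:Z - i%:Z)//; lia.
Qed.

End scale.

(** * Estimates for the weights *)

Section weight.
Context {R : realType} {X : metricType R}.
(** [T] is the ratio of a scale to the thickness of its shells. The bound on [l] lets a shell hold
    enough pieces of the next scale; the bound on [B] keeps [V n ^+ B] within a factor [2] over
    distances up to [scale l n]. *)
Variables (T : R) (l B : nat) (V chi : nat -> X -> R).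
Hypothesis T_ge1 : 1 <= T.
Hypothesis l_large : 8 * T <= 2 ^+ l.
Hypothesis B_large : 32 * T * B%:R <= 4 ^+ l.
Local Notation s n := (scale l (Posz n) / T).
Hypothesis V_0 : forall x, V 0 x = 1.
Hypothesis V_S : forall n x, V n.+1 x = V n x * chi n x.
Hypothesis chiP : forall n, shell_weight (scale l (Posz n)) (s n) (chi n).

Definition int_pos_part (n : int) : nat := if n is Posz m then m else 0.

(** The first factor is the square root of [scale l n]. It makes the weights decay geometrically
    even where every [chi] is [1]. At negative levels [V] is continued by [V 0 = 1]. *)
Definition weight (n : int) (x : X) : R :=
  (2 ^+ l) ^ (- n) * V (int_pos_part n) x ^+ B.

Let T0 : 0 < T. Proof. exact: lt_le_trans T_ge1. Qed.

Let L0 : 0 < 2 ^+ l :> R. Proof. exact: exprn_gt0. Qed.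

Let M2 : 4 ^+ l = 2 ^+ l * 2 ^+ l :> R.
Proof. by rewrite -exprMn -natrM. Qed.

Lemma weight_exponent_gt0 : (0 < l)%N.
Proof.
by case: (posnP l) l_large => // ->; rewrite expr0; have := T_ge1; lra.
Qed.
Let l0 := weight_exponent_gt0.

Let chi_gt0 n x : 0 < chi n x.
Proof.
have [/(_ x)/andP[+ _] _ _] := chiP n.
by apply: lt_le_trans; rewrite invr_gt0.
Qed.

Let V_gt0 n x : 0 < V n x.
Proof. by elim: n => [|n IH]; rewrite ?V_0// V_S mulr_gt0. Qed.

Let V_leS n x : V n.+1 x <= V n x.
Proof.
rewrite V_S ler_piMr ?(ltW (V_gt0 _ _))//.
by have [/(_ x)/andP[]] := chiP n.
Qed.

Lemma weight_gt0 n x : 0 < weight n x.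
Proof. by rewrite mulr_gt0 ?exprn_gt0 ?exprz_gt0. Qed.

Let V_step n x : 8^-1 * V (int_pos_part n) x <= V (int_pos_part (n + 1)) x /\
  V (int_pos_part (n + 1)) x <= V (int_pos_part n) x.
Proof.
have h m : 8^-1 * V m x <= V m x.
  by rewrite ler_piMl ?(ltW (V_gt0 _ _))// invf_le1 ?ler1n.
case: n => [m|[|m]] /=; rewrite ?lexx ?h//.
rewrite addn1 V_leS V_S mulrC ler_pM2l//.
by have [/(_ x)/andP[]] := chiP m.
Qed.

Let weightS n x : weight (n + 1) x =
  2 ^- l * ((2 ^+ l) ^ (- n) * V (int_pos_part (n + 1)) x ^+ B).
Proof. by rewrite /weight opprD expfzDr ?gt_eqF// exprN1; ring. Qed.

Let E0 (n : int) : 0 < (2 ^+ l) ^ n :> R. Proof. exact: exprz_gt0. Qed.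

Lemma weightS_lower n x : (2 ^+ l * 8 ^+ B)^-1 * weight n x <= weight (n + 1) x.
Proof.
rewrite weightS invfM -mulrA ler_pM2l ?invr_gt0// /weight mulrCA ler_pM2l//.
have [h _] := V_step n x.
by rewrite -exprVn -exprMn lerXn2r ?nnegrE ?(ltW (V_gt0 _ _))// mulr_ge0 ?(ltW (V_gt0 _ _)).
Qed.

Lemma weightS_upper n x : weight (n + 1) x <= 2 ^- l * weight n x.
Proof.
rewrite weightS ler_pM2l ?invr_gt0// /weight ler_pM2l//.
have [_ h] := V_step n x.
by rewrite lerXn2r ?nnegrE ?(ltW (V_gt0 _ _)).
Qed.

Lemma weight_addn_upper n k x : weight (n + k%:Z) x <= 2 ^- l ^+ k * weight n x.
Proof.
elim: k => [|k IH]; first by rewrite addr0 expr0 mul1r.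
have -> : n + k.+1%:Z = n + k%:Z + 1 by rewrite -addrA -PoszD addn1.
rewrite (le_trans (weightS_upper _ _))// exprS -mulrA.
by rewrite ler_pM2l ?invr_gt0.
Qed.

Lemma weight_addn_lower n k x :
  (2 ^+ l * 8 ^+ B)^-1 ^+ k * weight n x <= weight (n + k%:Z) x.
Proof.
elim: k => [|k IH]; first by rewrite addr0 expr0 mul1r.
have -> : n + k.+1%:Z = n + k%:Z + 1 by rewrite -addrA -PoszD addn1.
rewrite (le_trans _ (weightS_lower _ _))// exprS -mulrA.
by rewrite ler_pM2l// invr_gt0 mulr_gt0 ?exprn_gt0.
Qed.

Lemma weight_noninc (n m : int) x : n <= m -> weight m x <= weight n x.
Proof.
move=> nm; have -> : m = n + `|m - n|%N%:Z by rewrite gez0_abs ?subr_ge0// addrCA subrr addr0.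
rewrite (le_trans (weight_addn_upper _ _ _))// ler_piMl ?(ltW (weight_gt0 _ _))//.
by rewrite exprn_ile1 ?invr_ge0 ?(ltW L0)// invf_le1// exprn_ege1 ?ler1n.
Qed.

Lemma weight_Posz n x : weight (Posz n) x = 2 ^- l ^+ n * V n x ^+ B.
Proof. by rewrite /weight /= -exprnN exprVn. Qed.

Let a := 8 * T * B%:R.

(** As [chi i x] is at least [8^-1], the additive Lipschitz bound becomes a relative one:
    [chi i x * (1 - u) <= chi i y] with [u = 8 * mdist x y / s i]. Bernoulli's inequality then
    handles the [B]-th power. *)
Let chi_near i x y : 8 * T * 4 ^+ l ^+ i * mdist x y <= 1 ->
  chi i x ^+ B * (1 - a * 4 ^+ l ^+ i * mdist x y) <= chi i y ^+ B.
Proof.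
set u := (X in X <= 1) => u1.
have u0 : 0 <= u by rewrite /u !mulr_ge0 ?mdist_ge0// ?exprn_ge0 ?(ltW T0).
have [/(_ x)/andP[c8 c1] lip _] := chiP i.
have : chi i x * (1 - u) <= chi i y.
  have := lip x y; have -> : mdist x y / s i = u / 8.
    rewrite /scale -exprnN /u; field.
    by rewrite !gt_eqF ?exprn_gt0.
  have := ler_wpM2r u0 c8; lra.
move=> h; apply: le_trans (_ : (chi i x * (1 - u)) ^+ B <= _); last first.
  by rewrite lerXn2r ?nnegrE ?(ltW (chi_gt0 _ _))// mulr_ge0 ?subr_ge0 ?(ltW (chi_gt0 _ _)).
rewrite exprMn ler_pM2l ?exprn_gt0//.
apply: le_trans (bernoulli_le B _); last by rewrite u0.
by rewrite /u /a le_eqVlt; apply/orP; left; apply/eqP; ring.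
Qed.

Lemma weight_factor_ge0 n x : 0 <= V n x.
Proof. exact: ltW. Qed.

Lemma weight_small x e : 0 < e -> exists n, weight n x < e.
Proof.
move=> e0; set w := weight 0 x; have w0 : 0 < w by exact: weight_gt0.
exists (Posz (Num.Def.truncn (w / e)).+1).
have := weight_addn_upper 0 (Num.Def.truncn (w / e)).+1 x; rewrite add0r.
move=> /le_lt_trans; apply; rewrite -/w exprVn mulrC ltr_pdivrMr ?exprn_gt0//.
rewrite mulrC -ltr_pdivrMr//; apply: (lt_trans (truncnS_gt _)).
rewrite -exprM -natrX ltr_nat (leq_ltn_trans (leq_pmull _ l0))//.
exact: ltn_expl.
Qed.

(** The relative losses of [chi_near] over the levels below [n] grow geometrically, so the last one
    dominates, and [B_large] bounds their total by one half. At negative levels the weight does not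
    depend on the point. *)
Lemma weight_near n x y : mdist x y <= scale l n -> weight n x <= 2 * weight n y.
Proof.
case: n => [m|m] dm; last first.
  rewrite /weight /= !V_0 expr1n mulr1.
  by have := E0 (- Negz m); lra.
set d := mdist x y in dm.
have d0 : 0 <= d by exact: mdist_ge0.
have M0 : 0 < 4 ^+ l :> R by exact: exprn_gt0.
have M4 : 4 <= 4 ^+ l :> R by rewrite -[leLHS]expr1 ler_eXn2l ?ltr1n.
have Mmd : 4 ^+ l ^+ m * d <= 1.
  by rewrite mulrC -ler_pdivlMr ?exprn_gt0// mul1r; move: dm; rewrite /scale -exprnN.
have T4 : 8 * T <= 4 ^+ l.
  by apply: le_trans l_large _; rewrite M2 ler_peMr ?exprn_ege1 ?ler1n ?ltW.
have a0 : 0 <= a by rewrite /a !mulr_ge0 ?(ltW T0).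
(* The loss before level [k] is bounded by twice its last term, [2 * a * 4 ^+ l ^+ (k - 1) * d] for
   positive [k], written without subtraction. *)
have key k : (k <= m)%N ->
    V k x ^+ B * (1 - 2 * a / 4 ^+ l * (4 ^+ l ^+ k * d)) <= V k y ^+ B.
  elim: k => [|k IH] km.
    rewrite !V_0 expr1n mul1r expr0 mul1r gerBl !mulr_ge0//.
    by rewrite ?invr_ge0 ltW.
  have {}IH := IH (ltnW km).
  set w := 4 ^+ l ^+ k * d.
  have w0 : 0 <= w by rewrite /w mulr_ge0// exprn_ge0 ?ltW.
  have Mw : 4 ^+ l * w <= 1.
    rewrite /w mulrA -exprS; apply: le_trans Mmd; rewrite ler_wpM2r//.
    by rewrite ler_eXn2l// exprn_egt1 ?ltr1n// -lt0n.
  have := @chi_near k x y; rewrite -!(mulrA _ (4 ^+ l ^+ k)) -/d -/w.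
  rewrite (le_trans _ Mw) ?ler_wpM2r// => /(_ isT) ck.
  rewrite !V_S !exprMn exprSr.
  have -> : 4 ^+ l ^+ k * 4 ^+ l * d = 4 ^+ l * w by rewrite /w; ring.
  rewrite mulrA divfK ?gt_eqF//.
  rewrite -/w in IH.
  have Vy0 : 0 <= V k y ^+ B by rewrite exprn_ge0// ltW.
  have cy0 : 0 <= chi k y ^+ B by rewrite exprn_ge0// ltW.
  (* If the claimed factor is not positive, there is nothing to prove; otherwise both factors to be
     multiplied are nonnegative. *)
  have [neg|pos] := lerP (1 - 2 * a * w) 0.
    apply: le_trans (mulr_ge0 Vy0 cy0).
    by rewrite mulr_ge0_le0// mulr_ge0// exprn_ge0// ltW.
  have aw0 : 0 <= a * w by rewrite mulr_ge0.
  have M2' : 2 * a / 4 ^+ l * w <= a * w.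
    rewrite ler_wpM2r// ler_pdivrMr// mulrC ler_wpM2l//.
    by apply: le_trans M4; rewrite ler_nat.
  have Maw0 : 0 <= 2 * a / 4 ^+ l * w.
    apply: mulr_ge0 => //; apply: mulr_ge0; first exact: mulr_ge0.
    by rewrite invr_ge0 ltW.
  have Vx0 : 0 <= V k x ^+ B by rewrite exprn_ge0// ltW.
  have cx0 : 0 <= chi k x ^+ B by rewrite exprn_ge0// ltW.
  have f1 : 0 <= V k x ^+ B * (1 - 2 * a / 4 ^+ l * w) by apply: mulr_ge0 => //; lra.
  have f2 : 0 <= chi k x ^+ B * (1 - a * w) by apply: mulr_ge0 => //; lra.
  apply: le_trans (ler_pM f1 f2 IH ck).
  rewrite [leRHS]mulrACA; apply: ler_wpM2l; first exact: mulr_ge0.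
  have := mulr_ge0 aw0 Maw0; lra.
have km := key m (leqnn m).
have half : 2^-1 <= 1 - 2 * a / 4 ^+ l * (4 ^+ l ^+ m * d).
  have : 2 * a / 4 ^+ l * (4 ^+ l ^+ m * d) <= 2^-1 * 1.
    apply: ler_pM => //.
    - apply: mulr_ge0; first exact: mulr_ge0.
      by rewrite invr_ge0 ltW.
    - by rewrite mulr_ge0// exprn_ge0// ltW.
    - by rewrite ler_pdivrMr// /a; have := B_large; lra.
  lra.
rewrite !weight_Posz mulrCA ler_pM2l ?exprn_gt0 ?invr_gt0//.
have := ler_wpM2l (exprn_ge0 B (ltW (V_gt0 m x))) half; lra.
Qed.

(** On the shell [chi] is [1], so passing to the next level costs only the factor [2 ^- l], and
    [J = 2 * 2 ^ l] pieces make up for it. They need thickness about [4 * 2 ^+ l] times the next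
    scale; the shell has [4 ^+ l / T] times it, which suffices by [l_large]. *)
Lemma weight_shell (n : int) x : exists z t u,
  [/\ mdist z x <= t, 2 * t + u <= scale l n,
    (2 * 2 ^ l).+1%:R * (2 * scale l (n + 1)) <= u &
      forall w, t <= mdist z w <= t + u ->
        2 ^- l * weight n w <= weight (n + 1) w].
Proof.
have SE := scaleS (R := R) l0 n; rewrite M2 in SE.
have J3 : (2 * 2 ^ l).+1%:R <= 3 * 2 ^+ l :> R.
  rewrite -natr1 natrM natrX; have := l_large; have := T_ge1; lra.
have [H1 H2] : (2 * 2 ^ l).+1%:R * (2 * scale l (n + 1)) * T <= scale l n /\
    (2 * 2 ^ l).+1%:R * (2 * scale l (n + 1)) <= scale l n :> R.
  rewrite SE; set S := scale l (n + 1); set L := 2 ^+ l in J3 *.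
  set J := _.+1%:R in J3 *.
  have S0 : 0 < S by exact: scale_gt0.
  have h1 : J * (2 * S) <= 3 * L * (2 * S) by rewrite ler_pM2r ?mulr_gt0.
  have h2 : J * (2 * S) * T <= 3 * L * (2 * S) * T by rewrite ler_pM2r.
  have h3 : 8 * T * (L * S) <= L * (L * S) by rewrite ler_pM2r ?mulr_gt0.
  have h4 : 1 * (L * S) <= T * (L * S) by rewrite ler_pM2r ?mulr_gt0.
  have h5 : 0 < L * S by rewrite mulr_gt0.
  by split; lra.
(* At a negative level [V] does not change, so the whole ball about [x] serves as the shell. *)
case: n => [m|m] in SE H1 H2 *; last first.
  exists x, 0, (scale l (Negz m)); split; first by rewrite mdistxx.
  - by rewrite mulr0 add0r.
  - exact: H2.
  - move=> w _; rewrite weightS /weight.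
    have -> : int_pos_part (Negz m + 1) = 0%N by case: (m).
    by rewrite lexx.
have [_ _ /(_ x)[z [t [zx ts flat]]]] := chiP m.
have t0 : 0 <= t := le_trans (mdist_ge0 _ _) zx.
have s0 : 0 < s m by rewrite divr_gt0 ?scale_gt0.
exists z, t, (s m); split => //.
- lra.
- by rewrite ler_pdivlMr.
- move=> w /flat cw; rewrite weightS /weight /= addn1 V_S cw mulr1.
  by rewrite lexx.
Qed.

End weight.

(** * Power distortion *)

Lemma set_bij_cancel (S U : Type) (A : set S) (B : set U) (f : S -> U)
    (g : U -> S) :
  (forall x, A x -> B (f x)) -> (forall y, B y -> A (g y)) ->
  (forall x, A x -> g (f x) = x) -> (forall y, B y -> f (g y) = y) ->
  set_bij A B f.
Proof.
move=> fAB gBA fK gK; split.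
- by move=> x Ax; exact: fAB.
- by move=> x y /set_mem Ax /set_mem Ay fxy; rewrite -(fK x)// fxy fK.
- by move=> y By; exists (g y); [exact: gBA|exact: gK].
Qed.

Section power_homeomorphism.
Context {R : realType}.
Implicit Types (u : R) (j : nat).

Lemma iter_sqrt_ge0 j u : 0 <= u -> 0 <= iter j Num.sqrt u.
Proof. by move=> u0; case: j => [|j] //=; exact: sqrtr_ge0. Qed.

Lemma iter_sqrtK j u : 0 <= u -> iter j Num.sqrt u ^+ (2 ^ j) = u.
Proof.
move=> u0; elim: j => [|j IH]; first by rewrite expn0 expr1.
by rewrite expnS exprM /= sqr_sqrtr// iter_sqrt_ge0.
Qed.

Lemma sqr_iter_sqrt j u : 0 <= u -> iter j Num.sqrt (u ^+ (2 ^ j)) = u.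
Proof.
move=> u0; elim: j => [|j IH]; first by rewrite expn0 expr1.
by rewrite iterSr expnSr exprM sqrtr_sqr ger0_norm ?exprn_ge0.
Qed.

Lemma ler_iter_sqrt j u v : u <= v -> iter j Num.sqrt u <= iter j Num.sqrt v.
Proof. by move=> uv; elim: j => //= j IH; exact: ler_wsqrtr. Qed.

Lemma iter_sqrt_continuous j : continuous (iter j (@Num.sqrt R)).
Proof.
elim: j => [|j IH] u; first exact: cvg_id.
exact: (continuous_comp (IH u) (@sqrt_continuous R _)).
Qed.

(* Iterated square roots stand for the 2^j-th root.  The minimum of the inverses
   of two increasing functions is the inverse of their maximum. *)
Definition power_gauge (a : R) j (t : R) : R :=
  6 * Num.max (Num.sqrt (a * t)) ((a * t) ^+ (2 ^ j)).

Lemma power_gauge_homeomorphism (a : R) j : 0 < a ->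
  @homeomorphism_on R R `[0, +oo[ `[0, +oo[ (power_gauge a j).
Proof.
move=> a0.
pose g y := Num.min ((y / 6) ^+ 2) (iter j Num.sqrt (y / 6)) / a.
have f0 x : 0 <= x -> 0 <= power_gauge a j x.
  by move=> x0; rewrite mulr_ge0// le_max sqrtr_ge0.
have g0 y : 0 <= y -> 0 <= g y.
  move=> y0; rewrite /g divr_ge0 ?(ltW a0)// le_min sqr_ge0 /=.
  by rewrite iter_sqrt_ge0// divr_ge0.
have fK x : 0 <= x -> g (power_gauge a j x) = x.
  move=> x0; rewrite /g /power_gauge [6 * _]mulrC mulfK//.
  have ax0 : 0 <= a * x by rewrite mulr_ge0 ?(ltW a0).
  suff -> : Num.min (Num.max (Num.sqrt (a * x)) ((a * x) ^+ (2 ^ j)) ^+ 2)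
     (iter j Num.sqrt (Num.max (Num.sqrt (a * x)) ((a * x) ^+ (2 ^ j)))) = a * x.
    by rewrite mulrC mulKf// gt_eqF.
  case: (leP (Num.sqrt (a * x)) ((a * x) ^+ (2 ^ j))) => h.
    rewrite sqr_iter_sqrt// min_r// -[leLHS](sqr_sqrtr ax0).
    by rewrite lerXn2r ?nnegrE ?sqrtr_ge0 ?exprn_ge0.
  rewrite sqr_sqrtr// min_l// -[leLHS](sqr_iter_sqrt j ax0).
  by rewrite ler_iter_sqrt// ltW.
have gK y : 0 <= y -> power_gauge a j (g y) = y.
  move=> y0; rewrite /g /power_gauge [a * _]mulrC divfK ?gt_eqF//.
  set u := y / 6; have u0 : 0 <= u by rewrite divr_ge0.
  suff -> : Num.max (Num.sqrt (Num.min (u ^+ 2) (iter j Num.sqrt u)))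
     (Num.min (u ^+ 2) (iter j Num.sqrt u) ^+ (2 ^ j)) = u.
    by rewrite /u mulrC divfK.
  case: (leP (u ^+ 2) (iter j Num.sqrt u)) => h.
    rewrite sqrtr_sqr ger0_norm// max_l// -[leRHS](iter_sqrtK j u0).
    by rewrite lerXn2r ?nnegrE ?iter_sqrt_ge0 ?exprn_ge0.
  rewrite iter_sqrtK// max_r// -[leRHS](ger0_norm u0) -sqrtr_sqr ler_wsqrtr//.
  exact: ltW.
have pos (z : R) : `[0, +oo[%classic z <-> 0 <= z by rewrite /= in_itv /= andbT.
split.
- apply: (@set_bij_cancel _ _ _ _ _ g) => x /pos x0.
  + by apply/pos/f0.
  + by apply/pos/g0.
  + exact: fK.
  + exact: gK.
- apply: continuous_subspaceT => x; rewrite /power_gauge.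
  have ca : {for x, continuous (fun x : R => a * x)}.
    by apply: cvgM; [exact: cvg_cst|exact: cvg_id].
  apply: cvgM; first exact: cvg_cst.
  apply: (@continuous_max R R (fun t => Num.sqrt (a * t)) (fun t => (a * t) ^+ (2 ^ j))).
    exact: (continuous_comp ca (@sqrt_continuous R _)).
  exact: (continuous_comp ca (@exprn_continuous R _ _)).
- exists g; first by move=> x /set_mem/pos x0; exact: fK.
  apply: continuous_subspaceT => x; rewrite /g.
  have c6 : {for x, continuous (fun x : R => x / 6)}.
    by apply: cvgM; [exact: cvg_id|exact: cvg_cst].
  apply: cvgM; last exact: cvg_cst.
  apply: (@continuous_min R R (fun y => (y / 6) ^+ 2) (fun y => iter j Num.sqrt (y / 6))).
    exact: (continuous_comp c6 (@exprn_continuous R _ _)).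
  exact: (continuous_comp c6 (@iter_sqrt_continuous j _)).
Qed.

End power_homeomorphism.

Lemma int_leP (n m : int) : n <= m -> exists k : nat, m = n + k%:Z.
Proof.
move=> nm; exists `|(m - n)%R|%N.
by rewrite gez0_abs ?subr_ge0// addrCA subrr addr0.
Qed.

(** With [da] at level [n] and [db] at level [m], the quotient is at most [6 * W n / W (m + 1)]. The
    lower bound on ratios of weights gives a large power of [da / db] when [n <= m]; the upper bound
    gives a square root otherwise. The factor [(4 ^+ l) ^+ 2] absorbs the rounding to levels. *)
Lemma distortion_bound (R : realType) (l B : nat) (W : int -> R)
    (da db ra rb : R) : (0 < l)%N ->
  (forall n, 0 < W n) ->
  (forall n (k : nat), W (n + k%:Z) <= 2 ^- l ^+ k * W n) ->
  (forall n (k : nat), (2 ^+ l * 8 ^+ B)^-1 ^+ k * W n <= W (n + k%:Z)) ->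
  0 < da -> 0 < db ->
  (forall n, da <= scale l n -> ra <= 3 * W n) ->
  (forall n, scale l n < db -> W n / 2 <= rb) ->
  ra / rb <= power_gauge ((4 ^+ l) ^+ 2) (3 * B).+1 (da / db).
Proof.
move=> l0 W0 Wup Wlow da0 db0 ra_le rb_ge.
have [n /andP[nda dan]] := scale_level l0 da0.
have [m /andP[mdb dbm]] := scale_level l0 db0.
have {ra_le} ra_le := ra_le _ dan; have {rb_ge} rb_ge := rb_ge _ mdb.
have Wm0 := W0 (m + 1); have Wn0 := W0 n.
set M : R := 4 ^+ l; have M0 : 0 < M by exact: exprn_gt0.
have rb0 : 0 < rb by lra.
suff [A hA hE] : exists2 A, W n <= A * W (m + 1) &
    A <= Num.max (Num.sqrt (M ^+ 2 * (da / db))) ((M ^+ 2 * (da / db)) ^+ (2 ^ (3 * B).+1)).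
  rewrite ler_pdivrMr// /power_gauge.
  set G := Num.max _ _ in hE *.
  have h1 : A * W (m + 1) <= G * W (m + 1) by rewrite ler_pM2r.
  have G0 : 0 <= G by rewrite /G le_max sqrtr_ge0.
  have h2 : G * (W (m + 1) / 2) <= G * rb by rewrite ler_wpM2l.
  lra.
have [nm|mn] := leP n m.
  have [k kE] : exists k : nat, m + 1 = n + k%:Z.
    by apply: int_leP; rewrite ltW// ltzD1.
  have kmn : k%:Z + - m = 2%:Z + - (n + 1) by clear -kE; lia.
  exists ((2 ^+ l * 8 ^+ B) ^+ k).
    by have := Wlow n k; rewrite -kE exprVn -ler_pdivlMl ?invrK.
  rewrite le_max; apply/orP; right.
  (* Crude comparison of exponents: [l + 3 * B <= l * (3 * B).+1]. A power of two is taken because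
     the gauge is inverted by iterated square roots. *)
  apply: (@le_trans _ _ ((M ^+ k) ^+ (2 ^ (3 * B).+1))).
    rewrite exprAC lerXn2r ?nnegrE ?mulr_ge0 ?exprn_ge0 ?(ltW M0)//.
    rewrite /M (_ : 4 = 2 ^+ 2)%R; last by rewrite -natrX.
    rewrite (_ : 8 = 2 ^+ 3)%R; last by rewrite -natrX.
    rewrite -!exprM -exprD ler_eXn2l ?ltr1n//.
    have : (3 * B < 2 ^ (3 * B).+1)%N.
      by apply: (@leq_trans (3 * B).+1) => //; apply: ltnW; exact: ltn_expl.
    move: (2 ^ _)%N => p pB; clear -l0 pB.
    have : (l * (3 * B).+1 <= l * p)%N by rewrite leq_mul2l pB orbT.
    have : (3 * B <= l * (3 * B))%N by rewrite leq_pmull.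
    rewrite mulnS; lia.
  have Mk : M ^+ k * db <= M ^+ 2 * da.
    apply: (@le_trans _ _ (M ^+ k * scale l m)).
      by rewrite ler_pM2l ?exprn_gt0.
    apply: (@le_trans _ _ (M ^+ 2 * scale l (n + 1))); last first.
      by rewrite ler_pM2l ?exprn_gt0// ltW.
    rewrite /scale -/M !exprnP -!expfzDr ?gt_eqF//.
    by rewrite kmn.
  rewrite lerXn2r ?nnegrE ?exprn_ge0 ?(ltW M0)//.
    by rewrite mulr_ge0 ?exprn_ge0 ?(ltW M0)// divr_ge0 ?ltW.
  by rewrite mulrA ler_pdivlMr.
have [k kE] : exists k : nat, n = m + 1 + k%:Z.
  by apply: int_leP; rewrite lezD1.
have kmn : - m = k%:Z + 2%:Z + - (n + 1) by clear -kE; lia.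
exists (2 ^- l ^+ k); first by rewrite kE.
rewrite le_max; apply/orP; left.
have -> : 2 ^- l ^+ k = Num.sqrt (M ^+ k)^-1 :> R.
  have -> : M = 2 ^+ l * 2 ^+ l by rewrite /M -exprMn -natrM.
  rewrite exprMn invfM -expr2 sqrtr_sqr ger0_norm ?invr_ge0 ?exprn_ge0//.
  by rewrite exprVn.
apply: ler_wsqrtr.
rewrite mulrA ler_pdivlMr// ler_pdivrMl ?exprn_gt0// mulrA -exprD.
apply: (le_trans dbm); apply: (@le_trans _ _ (M ^+ (k + 2) * scale l (n + 1))).
  by rewrite /scale -/M exprnP -expfzDr ?gt_eqF// PoszD -kmn.
by rewrite ler_pM2l ?exprn_gt0// ltW.
Qed.

(** * Hausdorff measure of a limsup set *)

Section hausdorff.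
Context {R : realType} {Y : metricType R}.
Local Open Scope ereal_scope.

Lemma hausdorff_gauge_ge0 (s : R) (U : set Y) : 0 <= hausdorff_gauge s U.
Proof. by rewrite /hausdorff_gauge; case: ifP => // _; exact: poweR_ge0. Qed.

Lemma hausdorff_gauge_set0 (s : R) : hausdorff_gauge s (set0 : set Y) = 0.
Proof. by rewrite /hausdorff_gauge eqxx. Qed.

Lemma diameter_ge0 (U : set Y) : 0 <= diameter U.
Proof. by apply: ereal_sup_ubound; left. Qed.

Lemma diameter_le (U : set Y) (e : R) : (0 <= e)%R ->
  (forall x y, U x -> U y -> (mdist x y <= e)%R) -> diameter U <= e%:E.
Proof.
move=> e0 Ue; apply: ge_ereal_sup => _ [->|[x Ux [y Uy <-]]]; rewrite lee_fin//.
exact: Ue.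
Qed.

Lemma hausdorff_content_double (s d : R) (E : set Y) (U : nat -> nat -> set Y) :
  E `<=` \bigcup_n \bigcup_i U n i ->
  (forall n i, diameter (U n i) <= d%:E) ->
  hausdorff_content s d E <=
    \sum_(0 <= n <oo) \sum_(0 <= i <oo) hausdorff_gauge s (U n i).
Proof.
move=> EU Ud.
have /card_esym/card_set_bijP[e ebij] := card_nat2.
pose V j := U (e j).1 (e j).2.
have -> : \sum_(0 <= n <oo) \sum_(0 <= i <oo) hausdorff_gauge s (U n i) =
    \sum_(0 <= j <oo) hausdorff_gauge s (V j).
  rewrite [RHS]nneseries_esumT; last by move=> j; exact: hausdorff_gauge_ge0.
  rewrite -(@reindex_esum R _ _ _ _ e (fun k => hausdorff_gauge s (U k.1 k.2)) ebij).
  rewrite nneseries_esumT; last first.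
    by move=> n; apply: nneseries_ge0 => i _ _; exact: hausdorff_gauge_ge0.
  transitivity (\esum_(n in [set: nat]) \esum_(i in [set: nat]) hausdorff_gauge s (U n i)).
    apply: eq_esum => n _; apply: nneseries_esumT => i.
    exact: hausdorff_gauge_ge0.
  rewrite esum_esum; last by move=> n i _ _; exact: hausdorff_gauge_ge0.
  by congr esum; apply/seteqP; split.
apply: ereal_inf_lbound; exists V => //; split=> [x /EU[n _ [i _ Ux]]|j]; last exact: Ud.
have [_ _ esurj] := ebij; have [//|j _ ej] := esurj (n, i).
by exists j => //; rewrite /V ej.
Qed.

(** As in the Borel-Cantelli lemma, the sets with [n >= n0] cover [E], and their total gauge is the
    tail of a convergent geometric series. *)
Lemma hausdorff_measure_limsup (s C : R) (E : set Y) (U : nat -> nat -> set Y)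
    (N : nat -> nat) (d : nat -> R) : (0 < s)%R -> (0 <= C)%R ->
  (forall n i, (i < N n)%N -> diameter (U n i) <= (d n)%:E) ->
  (forall n, 0 <= d n <= C / 2 ^+ n)%R ->
  (forall n, (N n)%:R * d n `^ s <= C / 2 ^+ n)%R ->
  (forall x, E x -> forall n0, exists n i, [/\ (n0 <= n)%N, (i < N n)%N & U n i x]) ->
  hausdorff_measure s E = 0.
Proof.
move=> s0 C0 Ud dC NC EU; apply/eqP; rewrite eq_le; apply/andP; split; last first.
  apply: (@le_trans _ _ (hausdorff_content s 1 E)); last first.
    by apply: ereal_sup_ubound; exists 1%R => //=.
  apply: le_ereal_inf_tmp => _ [V _ <-].
  by apply: nneseries_ge0 => i _ _; exact: hausdorff_gauge_ge0.
apply: ge_ereal_sup => _ [delta /= delta0 <-].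
apply/lee_addgt0Pr => e e0; rewrite add0e.
(* The bound by [delta] controls the diameters; the bound by [e / 2] makes the gauges sum to at most
   [e]. *)
have [n0 n0C] : exists n0 : nat, (C / 2 ^+ n0 <= Num.min delta (e / 2))%R.
  set m := Num.min _ _; have m0 : (0 < m)%R by rewrite lt_min delta0 divr_gt0.
  exists (Num.Def.truncn (C / m)).+1.
  rewrite ler_pdivrMr ?exprn_gt0// mulrC -ler_pdivrMr//.
  apply: ltW; apply: lt_trans (truncnS_gt _) _.
  by rewrite -natrX ltr_nat ltn_expl.
move: n0C; rewrite le_min => /andP[n0d n0e].
pose V k i := if (i < N (n0 + k))%N then U (n0 + k)%N i else set0.
have Cn k : (C / 2 ^+ (n0 + k) <= C / 2 ^+ n0)%R.
  by rewrite ler_wpM2l// lef_pV2 ?posrE ?exprn_gt0// ler_eXn2l ?ltr1n// leq_addr.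
have EV : E `<=` \bigcup_k \bigcup_i V k i.
  move=> x /EU /(_ n0)[n [i [n0n iN Ux]]].
  by exists (n - n0)%N => //; exists i => //; rewrite /V subnKC// iN.
have Vdelta k i : diameter (V k i) <= delta%:E.
  rewrite /V; case: ifP => [iN|_]; last by apply: diameter_le => //; exact: ltW.
  apply: le_trans (Ud _ _ iN) _; rewrite lee_fin.
  have /andP[_ /le_trans->//] := dC (n0 + k)%N.
  exact: le_trans (Cn k) n0d.
apply: le_trans (hausdorff_content_double s EV Vdelta) _.
have inner k : \sum_(0 <= i <oo) hausdorff_gauge s (V k i) <= (e / (2 ^ k.+1)%:R)%:E.
  rewrite (nneseries_split 0 (N (n0 + k)%N)); last first.
    by move=> i _; exact: hausdorff_gauge_ge0.
  rewrite add0n [X in _ + X]eseries0 ?adde0; last first.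
    by move=> i Ni _; rewrite /V ltnNge Ni /= hausdorff_gauge_set0.
  apply: (@le_trans _ _ (\sum_(0 <= i < N (n0 + k)%N) (d (n0 + k)%N `^ s)%:E)).
    rewrite !big_mkord; apply: lee_sum => i _.
    rewrite /V ltn_ord /hausdorff_gauge; case: ifP => _.
      by rewrite lee_fin powR_ge0.
    rewrite -poweR_EFin; apply: gt0_ler_poweR.
    - exact: ltW.
    - by rewrite in_itv /= diameter_ge0 leey.
    - by have /andP[d0 _] := dC (n0 + k)%N; rewrite in_itv /= lee_fin d0 leey.
    - exact: Ud.
  rewrite big_mkord sumEFin lee_fin sumr_const card_ord -[leLHS]mulr_natl.
  apply: (le_trans (NC _)).
  rewrite exprD invfM mulrA natrX exprS invfM (mulrA e).
  by rewrite ler_pM2r// invr_gt0 exprn_gt0.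
apply: le_trans (@epsilon_trick0 R e xpredT (ltW e0)).
apply: lee_nneseries => // k _ _.
by apply: nneseries_ge0 => i _ _; exact: hausdorff_gauge_ge0.
Qed.

Lemma hausdorff_dim_ge0 (E : set Y) : 0 <= hausdorff_dim E.
Proof. by apply: le_ereal_inf_tmp => _ [s [s0 _] <-]; rewrite lee_fin. Qed.

End hausdorff.

(** * Quasisymmetry *)

Record is_distance {R : realType} {T : Type} (rho : T -> T -> R) := IsDistance {
  distance_xx : forall x, rho x x = 0;
  distance_eq0 : forall x y, rho x y = 0 -> x = y;
  distance_sym : forall x y, rho x y = rho y x;
  distance_triangle : forall y x z, rho x z <= rho x y + rho y z }.

Section metric_space_of.
Context {R : realType} {T : choiceType} (rho : T -> T -> R).

(** A copy of [T] tagged by the proof [rhoP], so that [rho] can be its metric whatever metric [T]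
    already has. *)
Definition metric_space_of & is_distance rho : Type := T.

Variable rhoP : is_distance rho.
HB.instance Definition _ := Choice.copy (metric_space_of rhoP) T.
HB.instance Definition _ := @isMetric.Build R (metric_space_of rhoP) rho
  (distance_xx rhoP) (distance_eq0 rhoP) (distance_sym rhoP) (distance_triangle rhoP).

End metric_space_of.

Lemma mdist_continuous_within (R : realType) (X Y : metricType R) (A : set X)
    (g : X -> Y) :
  (forall x e, A x -> 0 < e -> exists2 d, 0 < d &
    forall z, A z -> mdist x z < d -> mdist (g x) (g z) < e) ->
  {within A, continuous g}.
Proof.
move=> gP; apply/subspace_continuousP => x Ax; apply/cvg_ballP => e e0.
rewrite near_withinE; have [d d0 dP] := gP x e Ax e0.
apply/nbhs_ballP; exists d => //= z; rewrite !ballEmdist /= => xz Az.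
exact: dP.
Qed.

Lemma mdist_continuous (R : realType) (X Y : metricType R) (g : X -> Y) :
  (forall x e, 0 < e -> exists2 d, 0 < d &
    forall z, mdist x z < d -> mdist (g x) (g z) < e) ->
  continuous g.
Proof.
move=> gP; apply/continuous_subspace_setT; apply: mdist_continuous_within.
by move=> x e _ /(gP x)[d d0 dP]; exists d => // z _; exact: dP.
Qed.

Section quasisymmetry.
Context {R : realType} {X : metricType R}.
Variables (S : set X) (y0 : set_type S) (l B : nat) (W : int -> X -> R).
Variable rho : X -> X -> R.
Hypothesis l_gt0 : (0 < l)%N.
Hypothesis rho_upper : forall n x y, mdist x y <= scale l n -> rho x y <= 3 * W n x.
Hypothesis rho_lower : forall n x y, scale l n < mdist x y -> W n x / 2 <= rho x y.
Hypothesis W_gt0 : forall n x, 0 < W n x.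
Hypothesis W_small : forall x e, 0 < e -> exists n, W n x < e.
Hypothesis W_upper : forall x n (k : nat), W (n + k%:Z) x <= 2 ^- l ^+ k * W n x.
Hypothesis W_lower : forall x n (k : nat),
  (2 ^+ l * 8 ^+ B)^-1 ^+ k * W n x <= W (n + k%:Z) x.
Variable rhoP : is_distance (fun x y : set_type S => rho (val x) (val y)).
Local Notation Y := (metric_space_of rhoP).

(** The identity of [S], from the original metric to [rho]; points outside [S] are sent to [y0]. *)
Definition subspace_map (x : X) : Y := insubd y0 x.

Lemma subspace_mapK x : S x -> val (subspace_map x) = x.
Proof. by move=> Sx; rewrite insubdK// inE. Qed.

Lemma continuous_subspace_val : continuous (val : Y -> X).
Proof.
apply: mdist_continuous => y e e0.
have [n ne] := scale_small l_gt0 e0.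
exists (W n (val y) / 2) => [|z yz]; first by rewrite divr_gt0.
apply: le_lt_trans ne; rewrite leNgt; apply/negP => /rho_lower.
by rewrite leNgt yz.
Qed.

Lemma subspace_map_quasisymmetric : quasisymmetric_on S subspace_map.
Proof.
split; first split.
- apply: (@set_bij_cancel _ _ _ _ _ (val : Y -> X)) => //.
  + by move=> y _; exact: set_valP.
  + by move=> x Sx; exact: subspace_mapK.
  + by move=> y _; exact: valKd.
- apply: mdist_continuous_within => x e Sx e0.
  have [n ne] : exists n, W n x < e / 3 by apply: W_small; rewrite divr_gt0.
  exists (scale l n) => [|z Sz xz]; first exact: scale_gt0.
  rewrite /mdist /= !subspace_mapK//.
  have := rho_upper (ltW xz); lra.
- exists (val : Y -> X); first by move=> x /set_mem; exact: subspace_mapK.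
  by apply: continuous_subspaceT; exact: continuous_subspace_val.
exists (power_gauge ((4 ^+ l) ^+ 2) (3 * B).+1).
  by apply: power_gauge_homeomorphism; rewrite !exprn_gt0.
move=> x a b Sx Sa Sb xa xb _; rewrite /mdist /= !subspace_mapK//.
apply: (@distortion_bound R l B (W ^~ x)) => //.
- by rewrite mdist_gt0; apply/eqP.
- by rewrite mdist_gt0; apply/eqP.
- by move=> n; exact: rho_upper.
- by move=> n; exact: rho_lower.
Qed.

End quasisymmetry.

Lemma weight_chain_distP (R : realType) (X : metricType R) (T : R) (l B : nat)
    (V chi : nat -> X -> R) :
  1 <= T -> 8 * T <= 2 ^+ l -> 32 * T * B%:R <= 4 ^+ l ->
  (forall x, V 0 x = 1) -> (forall n x, V n.+1 x = V n x * chi n x) ->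
  (forall n, shell_weight (scale l (Posz n)) (scale l (Posz n) / T) (chi n)) ->
  let W := weight l B V in let rho := chain_dist (scale l) W in
  [/\ is_distance rho,
    forall n x y, mdist x y <= scale l n -> rho x y <= 3 * W n x &
    forall n x y, scale l n < mdist x y -> W n x / 2 <= rho x y].
Proof.
move=> T1 lT BT V0 VS chiP W rho.
have l0 : (0 < l)%N := weight_exponent_gt0 T1 lT.
have W0 n x : 0 < W n x by exact: weight_gt0 V0 VS chiP n x.
have r0 : forall n, 0 < scale l n :> R by exact: scale_gt0.
have rle : forall n m : int, n <= m -> scale l m <= scale l n :> R.
  exact: scale_noninc.
have Wle : forall (n m : int) x, n <= m -> W m x <= W n x.
  by move=> n m x; exact: weight_noninc V0 VS chiP n m x.
have Wnear n x y : mdist x y <= scale l n -> W n x <= 2 * W n y.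
  exact: weight_near T1 lT BT V0 VS chiP n x y.
have runb (a : R) : exists n, a <= scale l n.
  by have [n] := scale_unbounded l0 a; exists (- n%:Z).
have rsmall (e : R) : 0 < e -> exists n, scale l n < e.
  by move=> /(scale_small l0)[n]; exists n%:Z.
have lam0 : 0 < 2 ^- l :> R by rewrite invr_gt0 exprn_gt0.
have Jlam : 2 <= (2 * 2 ^ l)%:R * 2 ^- l :> R.
  by rewrite natrM natrX mulfK// gt_eqF// exprn_gt0.
have shell := weight_shell B T1 lT VS chiP.
split.
- split.
  + exact: chain_dist_xx W0 runb.
  + by move=> x y; exact: (chain_dist_eq0 W0 rle Wle Wnear r0 lam0 Jlam shell runb rsmall).
  + exact: chain_dist_sym W0 runb.
  + exact: chain_dist_triangle W0 runb.
- by move=> n x y; exact: (chain_dist_upper W0 Wnear).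
- by move=> n x y; exact: (chain_dist_lower W0 rle Wle Wnear r0 lam0 Jlam shell runb).
Qed.

(** * The conformal dimension *)

Lemma borel_limsup (Y : topologicalType) (O : nat -> set Y) :
  (forall n, open (O n)) ->
  borel [set y | forall n0, exists2 n, (n0 <= n)%N & O n y].
Proof.
move=> oO.
have [_ bC bU] : sigma_algebra setT (@borel Y) by exact: smallest_sigma_algebra.
have tail n0 : borel (setT `\` \bigcup_n O (n0 + n)%N).
  by apply: bC; apply: bU => n; apply: sub_sigma_algebra; exact: oO.
have := bC _ (bU _ tail); congr borel; apply/seteqP; split => y.
- move=> [_ nU] n0; apply: contrapT => nO; apply: nU; exists n0 => //.
  by split=> // -[n _ On]; apply: nO; exists (n0 + n)%N => //; exact: leq_addr.
- move=> lO; split=> // -[n0 _ [_ nU]]; apply: nU.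
  by have [n n0n On] := lO n0; exists (n - n0)%N => //; rewrite subnKC.
Qed.

Lemma spt_closed (R : realType) (X : pmetricType R) (mu : borel_measure X R) :
  closed (spt mu).
Proof.
rewrite -(setCK (spt mu)); apply: open_closedC.
rewrite openE => x /= /existsNP[U /not_implyP[[oU Ux] muU]].
apply: filterS (open_nbhs_nbhs (conj oU Ux)) => y Uy.
by move=> /(_ U (conj oU Uy)).
Qed.

(** The exponent [B] is linear in [l], at most [c * l]. For [l = 32 * T * c] the second bound
    reduces to [l * l <= 4 ^ l]. *)
Lemma exists_exponent (T D q : nat) : (0 < T)%N -> (0 < q)%N -> exists l,
  [/\ (8 * T <= 2 ^ l)%N &
      (32 * T * (q * ((2 * l + 2) * D + 1)) <= 4 ^ l)%N].
Proof.
move=> T0 q0; set c := (q * (4 * D + 1))%N.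
have c0 : (0 < c)%N by rewrite muln_gt0 q0 addn1.
pose l := (32 * (T * c))%N; exists l.
have l2 : (l < 2 ^ l)%N by exact: ltn_expl.
have l0 : (0 < l)%N by rewrite muln_gt0 /= muln_gt0 T0 c0.
split.
  apply: leq_trans (ltnW l2); rewrite /l.
  by apply: leq_mul => //; rewrite leq_pmulr.
have -> : (4 ^ l = 2 ^ l * 2 ^ l)%N by rewrite -expnMn.
apply: (@leq_trans (l * l)%N); last by rewrite leq_mul ?(ltnW l2).
have h : (q * ((2 * l + 2) * D + 1) <= c * l)%N.
  rewrite /c -mulnA leq_mul2l; apply/orP; right.
  move: l0; clear; move: l => l l0.
  have : (D <= l * D)%N by rewrite leq_pmull.
  by nia.
rewrite [leqRHS](_ : _ = (32 * T * (c * l))%N); last by rewrite {1}/l -!mulnA.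
by rewrite leq_mul2l h orbT.
Qed.

(** At level [n], at most [2 ^ (D * k n)] balls of radius half the scale cover a ball of radius
    [2 ^+ n]. Where [V n] is below [2 ^- n], each has new diameter at most [3 * 2 ^- (B * n)]. Since
    [B / q = (2 * l + 2) * D + 1], number times diameter to the power [1 / q] is at most
    [3 * 2 ^+ D / 2 ^+ n]. *)
Lemma hausdorff_measure_weight_limsup (R : realType) (X : metricType R) (D : nat)
    (doublingD : doubling_exponent X D)
    (l q : nat) (B := (q * ((2 * l + 2) * D + 1))%N) (V : nat -> X -> R)
    (Y : metricType R) (g : Y -> X) (p : X) :
  (0 < q)%N -> (forall n x, 0 <= V n x) ->
  (forall n x y, mdist (g x) (g y) <= scale l (Posz n) ->
    mdist x y <= 3 * weight l B V (Posz n) (g x)) ->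
  hausdorff_measure (q%:R^-1)
    [set y : Y | forall n0, exists2 n, (n0 <= n)%N & V n (g y) < 2 ^- n] = 0%E.
Proof.
move=> q0 V0 upper.
(* Of these halvings, [n] undo the radius [2 ^+ n], [2 * l * n] reach the scale, and one more turns
   radius into diameter. *)
pose k n := ((2 * l + 1) * n + 1)%N.
have /choice [c cP] : forall n, exists c : seq X, (size c <= 2 ^ (D * k n))%N /\
    ball p (2 ^+ n) `<=` \bigcup_(y in [set` c]) ball y (2 ^+ n / 2 ^+ k n).
  by move=> n; have [|c] := @doubling_iter _ _ _ doublingD (k n) p (2 ^+ n);
    [rewrite exprn_gt0|exists c].
have radius n : 2 ^+ n / 2 ^+ k n * 2 = scale l (Posz n) :> R.
  rewrite /scale -exprnN (_ : 4 = 2 ^+ 2)%R; last by rewrite -natrX.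
  rewrite /k -!exprM mulnDl mul1n addn1 exprSr exprD !invfM.
  rewrite mulnA; set u := 2 ^+ (2 * l * n)%N; set v := 2 ^+ n.
  by field; rewrite !gt_eqF ?exprn_gt0.
pose d n : R := 3 * 2 ^- (B * n).
pose U n i := [set y : Y | ball (nth p (c n) i) (2 ^+ n / 2 ^+ k n) (g y) /\
  V n (g y) < 2 ^- n].
apply: (@hausdorff_measure_limsup R Y _ (3 * 2 ^+ D) _ U (fun n => size (c n)) d).
- by rewrite invr_gt0 ltr0n.
- by rewrite mulr_ge0// exprn_ge0.
- move=> n i _; apply: diameter_le => [|x y [xb Vx] [yb _]].
    by rewrite mulr_ge0// invr_ge0 exprn_ge0.
  have dxy : mdist (g x) (g y) <= scale l (Posz n).
    move: xb yb; rewrite -radius !ballEmdist /= => xb yb.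
    have := metric_triangle (g x) (nth p (c n) i) (g y).
    rewrite (metric_sym (g x) (nth p (c n) i)); lra.
  apply: le_trans (upper _ _ _ dxy) _; rewrite ler_pM2l//.
  rewrite /weight /= -exprnN.
  apply: (@le_trans _ _ (1 * (2 ^- n) ^+ B)).
    apply: ler_pM; rewrite ?invr_ge0 ?exprn_ge0//.
      by rewrite invf_le1 ?exprn_ege1 ?exprn_gt0// ?exprn_ege1 ?ler1n.
    by rewrite lerXn2r ?nnegrE ?invr_ge0 ?exprn_ge0// ltW.
  by rewrite mul1r exprVn -exprM mulnC.
- move=> n; rewrite mulr_ge0 ?invr_ge0 ?exprn_ge0//= -mulrA ler_pM2l//.
  rewrite -[leLHS]mul1r; apply: ler_pM; rewrite ?invr_ge0 ?exprn_ge0//.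
    by rewrite exprn_ege1 ?ler1n.
  rewrite lef_pV2 ?posrE ?exprn_gt0// ler_eXn2l ?ltr1n//.
  by rewrite leq_pmull// /B muln_gt0 q0 addn1.
- move=> n; pose m := (n * ((2 * l + 2) * D + 1))%N.
  (* The constant survives the root because [3 <= 3 ^+ q]. *)
  have root : d n `^ q%:R^-1 <= 3 * 2 ^- m.
    have x0 : 0 <= 3 * 2 ^- m :> R by rewrite mulr_ge0// invr_ge0 exprn_ge0.
    have -> : 3 * 2 ^- m = ((3 * 2 ^- m) ^+ q) `^ q%:R^-1 :> R.
      rewrite -(powR_mulrn q x0) -powRrM mulfV ?powRr1//.
      by rewrite pnatr_eq0 -lt0n.
    apply: ge0_ler_powR; rewrite ?invr_ge0 ?ler0n// ?nnegrE ?exprn_ge0//.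
      by rewrite mulr_ge0// invr_ge0 exprn_ge0.
    rewrite /d exprMn exprVn -exprM.
    have -> : (B * n = m * q)%N by rewrite /B /m [RHS]mulnC -mulnA [in RHS](mulnC n).
    by rewrite ler_wpM2r ?invr_ge0 ?exprn_ge0// ler_eXnr// ler1n.
  have size_le : (size (c n))%:R <= 2 ^+ (D * k n) :> R.
    by rewrite -natrX ler_nat; exact: (cP n).1.
  apply: le_trans (ler_pM _ _ size_le root) _; rewrite ?powR_ge0//.
  rewrite mulrCA -mulrA ler_pM2l// ler_pdivrMr ?exprn_gt0// mulrAC.
  rewrite ler_pdivlMr ?exprn_gt0// -!exprD ler_eXn2l ?ltr1n//.
  by rewrite /m /k; nia.
move=> y Ey n0.
(* Taking [n] beyond the distance from [p] to [g y] puts [g y] into the ball of radius [2 ^+ n]. *)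
have [n nn0 Vn] := Ey (maxn n0 (Num.Def.truncn (mdist p (g y))).+1).
move: nn0; rewrite geq_max => /andP[n0n pn].
have py : ball p (2 ^+ n) (g y).
  rewrite ballEmdist /=; apply: (lt_trans (truncnS_gt _)).
  by rewrite -natrX ltr_nat (leq_ltn_trans pn)// ltn_expl.
have [z /= zc zy] := (cP n).2 _ py.
exists n, (index z (c n)); split=> //; first by rewrite index_mem.
by split=> //; rewrite nth_index.
Qed.

(** With empty support, null open sets would cover the space, and countably many of them would
    suffice. *)
Lemma spt_nonempty (R : realType) (X : pmetricType R) (mu : borel_measure X R)
    (D : nat) (doublingD : doubling_exponent X D) :
  mu [set: X] <> 0%E -> spt mu !=set0.
Proof.
move=> muX; apply: contrapT => S0; apply: muX.
have [|||U [oU U0 UX]] := @doubling_lindelof R X D doublingD point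
    (fun U => open U /\ mu U = 0%E) [set: X].
- by split; [exact: open0|exact: measure0].
- move=> U V oU UV [oV V0]; split => //; apply/eqP.
  rewrite eq_le measure_ge0 andbT -V0.
  by apply: le_measure => //; rewrite inE; exact: open_borel.
- move=> x _; have /existsNP[U /not_implyP[oUx muU]] : ~ spt mu x.
    by move=> Sx; apply: S0; exists x.
  exists U => //; split; first by case: oUx.
  by apply/eqP; rewrite eq_le measure_ge0 andbT leNgt; apply/negP.
have : mu.-negligible (\bigcup_i U i).
  apply: negligible_bigcup => i; exists (U i); split => //; first exact: open_borel.
  by have [] := U0 i.
have -> : \bigcup_i U i = [set: X] by apply/seteqP; split.
exact: (@measure_negligible _ _ _ mu [set: X]).
Qed.

Lemma small_dimensional_image (R : realType) (X : pmetricType R)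
    (mu : borel_measure X R) (D : nat)
    (doublingD : doubling_exponent X D) (q : nat) :
  locally_finite mu -> spt mu !=set0 -> (0 < q)%N ->
  exists (Y : metricType R) (f : X -> Y), quasisymmetric_on (spt mu) f /\
    (measure_hausdorff_dim (spt_pushforward mu f) <= (q%:R^-1)%:E)%E.
Proof.
move=> lf [p0 Sp0] q0.
have [|||U [oU Uoo UX]] := @doubling_lindelof R X D doublingD point
    (fun U => open U /\ (mu U < +oo)%E) [set: X].
- by split; [exact: open0|rewrite measure0].
- move=> U V oU UV [oV Voo]; split => //; apply: le_lt_trans Voo.
  by apply: le_measure => //; rewrite inE; exact: open_borel.
- by move=> x _; have [U oU Uoo] := lf x; exists U => //; split=> //; case: oU.
have [nu nuoo numu] := finite_dominating_measure oU (fun i => (Uoo i).2) UX.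
(* This is the ratio required by [shell_family], as a natural number for use in
   [exists_exponent]. *)
have [Tn Tn0 TE] : exists2 Tn : nat, (0 < Tn)%N &
    Tn%:R = 512 * (2 ^ (D * 2))%:R :> R.
  exists (512 * 2 ^ (D * 2))%N; last exact: natrM.
  by rewrite muln_gt0 expn_gt0.
pose T : R := Tn%:R.
have [l [lT lB]] := exists_exponent D Tn0 q0.
set B := (q * _)%N in lB.
have T1 : 1 <= T by rewrite ler1n.
have lTR : 8 * T <= 2 ^+ l by rewrite -natrM -natrX ler_nat.
have BTR : 32 * T * B%:R <= 4 ^+ l by rewrite -!natrM -natrX ler_nat.
have l0 : (0 < l)%N := weight_exponent_gt0 T1 lTR.
have [|V [chi [V0 VS chiP Vnull]]] :=
    weight_sequence (s := fun n => scale l (Posz n) / T) doublingD nuoo.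
  by move=> n; rewrite divr_gt0 ?scale_gt0// (lt_le_trans ltr01).
have {}chiP n : shell_weight (scale l (Posz n)) (scale l (Posz n) / T) (chi n).
  have := chiP n; rewrite (_ : 512 * _ * _ = scale l (Posz n))//.
  by rewrite -TE mulrC divfK// gt_eqF// (lt_le_trans ltr01).
have W0 := weight_gt0 B V0 VS chiP.
have [rhoP up low] := weight_chain_distP T1 lTR BTR V0 VS chiP.
set W := weight l B V in W0 up low rhoP; set rho := chain_dist _ _ in rhoP up low.
pose S := spt mu.
have rhoSP : is_distance (fun x y : set_type S => rho (val x) (val y)).
  case: rhoP => r1 r2 r3 r4; split => //.
  by move=> x y /r2/val_inj.
pose Y : metricType R := metric_space_of rhoSP.
pose y0 : set_type S := SigSub (mem_set Sp0).
pose f : X -> Y := subspace_map y0 rhoSP.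
exists Y, f; split.
  apply: (@subspace_map_quasisymmetric R X S y0 l B W rho) => //.
  - by move=> x e; exact: weight_small V0 VS chiP x e.
  - by move=> x n k; exact: weight_addn_upper V0 VS chiP n k x.
  - by move=> x n k; exact: weight_addn_lower V0 VS chiP n k x.
pose E := [set y : Y | forall n0, exists2 n, (n0 <= n)%N & V n (val y) < 2 ^- n].
have cV n : continuous (V n).
  elim: n => [|n IH].
    by rewrite (_ : V 0 = fun=> 1); [exact: cst_continuous|apply/funext].
  rewrite (_ : V n.+1 = fun x => V n x * chi n x); last exact/funext.
  move=> x; apply: cvgM; first exact: IH.
  have [_ lip _] := chiP n.
  apply: lipschitz_continuous lip x.
  by rewrite divr_gt0 ?scale_gt0// (lt_le_trans ltr01).
have cval : continuous (val : Y -> X).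
  exact: (continuous_subspace_val l0 low W0).
have fK x : S x -> val (f x) = x by exact: subspace_mapK.
apply: (@le_trans _ _ (hausdorff_dim E)); last first.
  apply: ereal_inf_lbound; exists q%:R^-1 => //; split; first by rewrite invr_ge0.
  apply: (hausdorff_measure_weight_limsup doublingD (l := l) point q0).
    by move=> n x; exact: weight_factor_ge0 V0 VS chiP n x.
  by move=> n x y; exact: up.
apply: ereal_inf_lbound; exists E => //; split.
  apply: borel_limsup => n.
  rewrite [X in open X](_ : _ = (V n \o (val : Y -> X)) @^-1` `]-oo, 2 ^- n[%classic).
    apply: open_comp; last exact: interval_open.
    by move=> y _; apply: continuous_comp; [exact: cval|exact: cV].
  by apply/seteqP; split => y /=; rewrite in_itv.
rewrite /spt_pushforward.
pose F k := [set x | forall n, (k <= n)%N -> 2 ^- n <= V n x].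
have Fclosed k : closed (F k).
  rewrite (_ : F k = \bigcap_(n in [set n | (k <= n)%N]) (V n @^-1` `[2 ^- n, +oo[%classic)).
    apply: closed_bigI => n _; apply: closed_comp; last exact: interval_closed.
    by move=> x _; exact: cV.
  apply/seteqP; split => x Fx n kn; have := Fx n kn; rewrite /= in_itv /= ?andbT//.
(* Within the support, the complement of [E] consists of the points where [V n < 2 ^- n] fails from
   some [k] on; each [F k] is [nu]-null, hence [mu]-null. *)
have -> : spt mu `&` f @^-1` (~` E) = spt mu `&` \bigcup_k F k.
  apply/seteqP; split => x [Sx]; rewrite /= /E /=.
    move=> /existsNP[k nE]; split => //; exists k => // n kn.
    rewrite leNgt; apply/negP => Vn; apply: nE; exists n => //.
    by rewrite fK.
  move=> [k _ Fk]; split=> // /(_ k)[n kn].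
  by rewrite fK// ltNge Fk.
apply: measure_negligible.
  apply: measurableI; first by apply: closed_borel; exact: spt_closed.
  by apply: bigcupT_measurable => k; exact: closed_borel.
apply: (@negligibleS _ _ _ mu (\bigcup_k F k)); first by move=> x [].
by apply: negligible_bigcup => k; apply: numu; exact: Vnull.
Qed.

Lemma conformal_dim_ge0 (R : realType) (X : pmetricType R)
    (mu : borel_measure X R) : (0 <= conformal_dim mu)%E.
Proof.
apply: le_ereal_inf_tmp => _ [Y [f [_ ->]]].
by apply: le_ereal_inf_tmp => _ [E _ <-]; exact: hausdorff_dim_ge0.
Qed.

Theorem corollary1p2 (R : realType) (X : pmetricType R)
    (mu : borel_measure X R) :
  doubling X -> locally_finite mu -> mu [set: X] <> 0%E ->
  conformal_dim mu = 0%E.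
Proof.
move=> [D doublingN] lf muX.
(* Since [D < 2 ^ D], the doubling constant itself serves as the exponent. *)
have doublingD : doubling_exponent X D.
  move=> x r /(doublingN x)[c cD cov]; exists c => //.
  by rewrite (leq_trans cD)// ltnW// ltn_expl.
apply/eqP; rewrite eq_le conformal_dim_ge0 andbT.
apply/lee_addgt0Pr => e e0; rewrite add0e.
set q := (Num.Def.truncn e^-1).+1.
have [Y [f [fqs fdim]]] :=
  @small_dimensional_image R X mu D doublingD q lf (spt_nonempty doublingD muX) (ltn0Sn _).
apply: (@le_trans _ _ (q%:R^-1)%:E).
  by apply: le_trans fdim; apply: ereal_inf_lbound; exists Y, f.
by rewrite lee_fin invf_ple ?posrE ?ltr0n// ltW// truncnS_gt.
Qed.
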